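(* Every smooth cubic surface in $\mathbb{P}^3$ (over $\mathbb{C}$) is a Poncelet surface.
   Context: Work over $\mathbb{C}$. Let $V$ be a complex vector space of dimension $2$ and $S_i=\mathrm{Sym}^i(V)$, viewed as the space of binary forms of degree $i$ (so $\dim S_i=i+1$). Let $\mathbb{P}(S_n^\vee)\cong\mathbb{P}^n$ denote the projective space whose points are the lines $[h]$ in $S_n$, so that its linear forms are the elements of $S_n^\vee$. For integers $n\ge 1$, $k\ge 0$, multiplication of binary forms $S_k\otimes S_n\to S_{n+k}$ defines the Schwarzenberger bundle $E_{n,n+k}$, of rank $n$ on $\mathbb{P}(S_n^\vee)$, by the exact sequence $$0\to S_k\otimes\mathcal{O}_{\mathbb{P}(S_n^\vee)}(-1)\to S_{n+k}\otimes\mathcal{O}_{\mathbb{P}(S_n^\vee)}\to E_{n,n+k}\to 0,$$ where at the point $[h]$ the first map is $g\mapsto gh$. One has $H^0(E_{n,n+k})\cong S_{n+k}$, so binary forms of degree $n+k$ are sections of $E_{n,n+k}$. For $1\le r\le n$ and linearly independent sections $f_1,\dots,f_r\in S_{n+k}$ of $E_{n,n+k}$, the Poncelet variety defined by them is the closed subscheme of $\mathbb{P}(S_n^\vee)$ with equation $f_1\wedge\cdots\wedge f_r=0$ (vanishing of this section of $\bigwedge^r E_{n,n+k}$). When $r=n$ it is a Poncelet hypersurface of degree $k+1$; writing $\Lambda=\langle f_1,\dots,f_n\rangle$, its equation is the determinant of the induced $(k+1)\times(k+1)$ matrix of linear forms $S_k\otimes\mathcal{O}(-1)\to (S_{n+k}/\Lambda)\otimes\mathcal{O}$.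 A subscheme of $\mathbb{P}^n$ is called a Poncelet variety (hypersurface) if it becomes one under some linear isomorphism $\mathbb{P}^n\cong\mathbb{P}(S_n^\vee)$ (equivalently, for some choice of a rational normal curve in $\mathbb{P}^n$). A Poncelet surface of degree $d$ is a Poncelet hypersurface in $\mathbb{P}^3$ with $n=3$, $k=d-1$; for cubic surfaces, $n=3$ and $k=2$. *)

(* Defs.v *)
From HB Require Import structures.
From mathcomp Require Import all_boot all_order all_algebra.
From mathcomp Require Import reals complex mpoly.

Set Implicit Arguments.
Unset Strict Implicit.
Unset Printing Implicit Defensive.

Import GRing.Theory.
Local Open Scope ring_scope.

Section BinaryForms.
Variable C : fieldType.

Definition bform (d : nat) := dhomog 2 C d.

Lemma bmul_subproof n k (h : bform n) (g : bform k) :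
  (mpoly_of_dhomog h * mpoly_of_dhomog g) \is (n + k).-homog.
Proof. by apply: dhomogM; apply: dhomog_is_dhomog. Qed.

Definition bmul n k (h : bform n) (g : bform k) : bform (n + k) :=
  DHomog (bmul_subproof h g).

Lemma bmono_subproof d (i : 'I_d.+1) :
  ('X_ord0 ^+ i * 'X_ord_max ^+ (d - i) : {mpoly C[2]}) \is d.-homog.
Proof.
have Xh (j : 'I_2) m : ('X_j ^+ m : {mpoly C[2]}) \is m.-homog.
  by rewrite -[X in X.-homog]mul1n; apply: dhomogMn; rewrite dhomogX /= mdeg1.
have := dhomogM (Xh ord0 i) (Xh ord_max (d - i)%N).
by rewrite subnKC // -ltnS.
Qed.

(* The monomials x^i y^(d-i), 0 <= i <= d: the basis used for S_d. *)
Definition bmono d (i : 'I_d.+1) : bform d := DHomog (bmono_subproof i).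

End BinaryForms.

Section Poncelet.
Variable C : fieldType.

(* The linear map S_k (x) O(-1) -> (S_(n+k) / Lambda) (x) O, as a matrix of
   linear forms.  The quotient S_(n+k) / Lambda is presented by a linear map
   q : S_(n+k) -> C^(k+1) with kernel Lambda.  The coordinates on the space of
   lines [h] in S_n are the coefficients of h on the monomial basis, so row i
   is q (h * g_i) for h = \sum_l 'X_l x^l y^(n-l) and g_i = x^i y^(k-i). *)
Definition poncelet_mx n k (q : 'Hom(bform C (n + k), 'rV[C]_k.+1)) :
    'M[{mpoly C[n.+1]}]_k.+1 :=
  \matrix_(i, j)
    \sum_(l < n.+1) (q (bmul (bmono C l) (bmono C i)) 0 j) *: 'X_l.

(* G is an equation of the Poncelet hypersurface f_1 /\ ... /\ f_n = 0 in the
   space of lines in S_n.  Since f is free, Lambda = <<f>> has codimension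
   k + 1, so that q is onto; another choice of q, or of bases, changes the
   determinant by a nonzero scalar only. *)
Definition poncelet_equation n k (f : n.-tuple (bform C (n + k)))
    (G : {mpoly C[n.+1]}) : Prop :=
  exists2 q : 'Hom(bform C (n + k), 'rV[C]_k.+1),
    lker q = <<f>>%VS & G = \det (poncelet_mx q).

(* Equality of the closed subschemes of projective space cut out by two nonzero
   homogeneous polynomials. *)
Definition same_hypersurface m (F G : {mpoly C[m]}) : Prop :=
  exists2 c : C, c != 0 & F = c *: G.

(* F o A, for A acting on column vectors *)
Definition lin_subst m (A : 'M[C]_m) (F : {mpoly C[m]}) : {mpoly C[m]} :=
  F \mPo [tuple \sum_(j < m) A i j *: 'X_j | i < m].

(* The hypersurface F = 0 of P^n becomes Poncelet, for sections of E_(n,n+k),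
   under a linear isomorphism between P^n and the space of lines in S_n. *)
Definition poncelet_hypersurface n k (F : {mpoly C[n.+1]}) : Prop :=
  exists A : 'M[C]_n.+1, exists f : n.-tuple (bform C (n + k)),
  exists G : {mpoly C[n.+1]},
    [/\ A \in unitmx, free f, poncelet_equation f G
      & same_hypersurface (lin_subst A F) G].

(* k = d - 1, for d > 0 *)
Definition poncelet_surface d (F : {mpoly C[4]}) : Prop :=
  @poncelet_hypersurface 3 d.-1 F.

(* Jacobian criterion at the C-points of the affine cone, meaningful for C
   algebraically closed. *)
Definition smooth_hypersurface m (F : {mpoly C[m]}) : Prop :=
  forall v : 'I_m -> C, (exists i, v i != 0) -> F.@[v] = 0 ->
    exists i, (F^`M(i)).@[v] != 0.

End Poncelet.

(* Main.v *)
Require Import Defs.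
From HB Require Import structures.
From mathcomp Require Import all_boot all_order all_algebra perm.
From mathcomp Require Import reals complex mpoly.
From mathcomp Require Import ring zify.

Set Implicit Arguments.
Unset Strict Implicit.
Unset Printing Implicit Defensive.

Import GRing.Theory Num.Theory.
Local Open Scope ring_scope.

(** A smooth cubic surface contains a twisted cubic curve, and every twisted cubic
    on it gives a Poncelet structure.

    In suitable coordinates X_0, .., X_3 a cubic surface through a twisted cubic
    is the determinant of a matrix with rows (X_i, X_(i+1), m_i(X)), i = 0, 1, 2,
    where the m_i are linear forms ([scroll_cubic]).  The matrix of a Poncelet
    surface has three Hankel columns.  Substitute X_l = sum_k c_(l+k) h_k: the
    first two columns become Hankel in h for every sequence c_0, .., c_6, and for
    the third column this is a system of six linear equations on the seven
    unknowns c_a ([hankelization]).  These equations say that the functional c on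
    binary sextics kills the quadratic multiples of the two binary quartics
    x m_i - y m_(i+1), i = 0, 1, restricted to the twisted cubic.  At a common zero
    of the quartics the matrix would have rank one, and the surface would be
    singular ([quartics_coprime]).  So they are coprime, and then no nonzero cubic
    h is apolar to c ([apolar_cubic_trivial]), which makes the substitution
    invertible.

    The twisted cubic comes from lines.  A smooth cubic surface contains a line
    ([exists_line]).  To see this, take a cuspidal tangent section, parametrized by
    a; the existence of a line of the surface through the point with parameter a is
    the vanishing of a polynomial in a whose degree is exactly 27
    ([line_of_cusp]).  A cuspidal section exists because the Hessian has a zero on
    the normalization of a nodal tangent section which is not above the node
    ([node_parabolic]).  Next, the residual conics in the planes through a line
    degenerate at simple roots of their discriminant, by smoothness
    ([Delta_derivative]), so that there are two degenerate planes and with them a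
    chain of three lines spanning the space ([chain_of_line]).  The equation of a
    surface through such a chain is a determinant of linear forms with two zero
    entries ([chain_cubic]), in which a general pencil of rows has no degenerate
    member; its Kronecker normal form is that of a twisted cubic
    ([kronecker_pencil], [chain_to_scroll]).

    Geometry is done with the polar form T of the cubic F, the symmetric trilinear
    form with T(v, v, v) = F(v): then F is smooth when T(v, v, _) is nonzero for
    every nonzero v ([polar_smooth]). *)

(** * Binary forms and apolarity *)

Section BinaryForms.
Variable C : numClosedFieldType.
Implicit Types x y : C.

Lemma closed_root_size (p : {poly C}) : (1 < size p)%N -> exists x, root p x.
Proof. by move=> hp; apply/closed_rootP; rewrite neq_ltn hp orbT. Qed.

Lemma binary_quadratic_zero (a b c : C) :
  exists x y, (x, y) != 0 /\ a * x ^+ 2 + b * x * y + c * y ^+ 2 = 0.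
Proof.
have [->|a0] := eqVneq a 0.
  by exists 1, 0; split; [rewrite xpair_eqE oner_eq0 | ring].
have [r] : exists r, root (a *: 'X^2 + (b *: 'X + c%:P)) r.
  apply: closed_root_size; rewrite size_polyDl size_scale ?size_polyXn //.
  by rewrite (leq_ltn_trans (size_polyD _ _)) // gtn_max size_polyC
     (leq_ltn_trans (size_scale_leq _ _)) ?size_polyX //; case: (c != 0).
rewrite rootE !hornerE /= => /eqP hr.
by exists r, 1; split; [rewrite xpair_eqE oner_eq0 andbF | rewrite -hr; ring].
Qed.

Lemma binary_cubic_zero (a b c d : C) :
  exists x y, (x, y) != 0 /\
    a * x ^+ 3 + b * x ^+ 2 * y + c * x * y ^+ 2 + d * y ^+ 3 = 0.
Proof.
have [->|a0] := eqVneq a 0.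
  by exists 1, 0; split; [rewrite xpair_eqE oner_eq0 | ring].
have [r] : exists r, root (a *: 'X^3 + (b *: 'X^2 + (c *: 'X + d%:P))) r.
  apply: closed_root_size; rewrite size_polyDl size_scale ?size_polyXn //.
  rewrite (leq_ltn_trans (size_polyD _ _)) // gtn_max.
  rewrite (leq_ltn_trans (size_scale_leq _ _)) ?size_polyXn //=.
  by rewrite (leq_ltn_trans (size_polyD _ _)) // gtn_max size_polyC
     (leq_ltn_trans (size_scale_leq _ _)) ?size_polyX //; case: (d != 0).
rewrite rootE !hornerE /= => /eqP hr.
by exists r, 1; split; [rewrite xpair_eqE oner_eq0 andbF | rewrite -hr; ring].
Qed.

Lemma binary_quadratic_factor (a b c : C) : exists p q r s,
  [/\ a = p * r, b = p * s + q * r & c = q * s].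
Proof.
have [x [y [nz e]]] := binary_quadratic_zero a b c.
have [y0|y0] := eqVneq y 0.
  have x0 : x != 0 by apply: contraNneq nz => ->; rewrite y0.
  exists 0, 1, b, c; split; try ring.
  apply: (mulIf (expf_neq0 2 x0)); rewrite !mul0r -e y0; ring.
exists y, (- x), (a / y), ((b + a * x / y) / y); split; try by field.
by apply: (mulIf (expf_neq0 2 y0)); apply/eqP; rewrite -subr_eq0 -e; apply/eqP; field.
Qed.

Lemma binary_cubic_factor (a b c d : C) : exists p1 q1 p2 q2 p3 q3,
  [/\ a = p1 * p2 * p3, b = p1 * p2 * q3 + p1 * q2 * p3 + q1 * p2 * p3,
      c = p1 * q2 * q3 + q1 * p2 * q3 + q1 * q2 * p3 & d = q1 * q2 * q3].
Proof.
have [x [y [nz e]]] := binary_cubic_zero a b c d.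
have [y0|y0] := eqVneq y 0.
  have x0 : x != 0 by apply: contraNneq nz => ->; rewrite y0.
  have a0 : a = 0 by apply: (mulIf (expf_neq0 3 x0)); rewrite mul0r -e y0; ring.
  have [p [q [r [s [-> -> ->]]]]] := binary_quadratic_factor b c d.
  by exists 0, 1, p, q, r, s; split; rewrite ?a0; ring.
have [p [q [r [s [e1 e2 e3]]]]] :=
  binary_quadratic_factor (a / y) ((b + a * x / y) / y)
    ((c + (b + a * x / y) * x / y) / y).
exists y, (- x), p, q, r, s; split.
- by rewrite -mulrA -e1; field.
- have -> : b = y * ((b + a * x / y) / y) - x * (a / y) by field.
  rewrite e1 e2; ring.
- have -> : c = y * ((c + (b + a * x / y) * x / y) / y) - x * ((b + a * x / y) / y).
    by field.
  rewrite e2 e3; ring.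
rewrite -mulrA -e3; apply: (mulIf (expf_neq0 3 y0)).
by apply/eqP; rewrite -subr_eq0 -e; apply/eqP; field.
Qed.

End BinaryForms.

Section Apolarity.
Variable C : numClosedFieldType.
Implicit Types (c h : nat -> C) (n j k : nat).

(** Read c as the functional sending x^a y^(n-a) to c a on binary forms of degree n.
    The hypothesis is that it kills the multiples of p x + q y, and so it must be a
    multiple of the evaluation at the zero (-q, p). *)
Lemma annihilated_by_linear c n (p q : C) : (p, q) != 0 ->
  (forall a, (a < n)%N -> p * c a.+1 + q * c a = 0) ->
  exists l, forall a, (a <= n)%N -> c a = l * p ^+ (n - a) * (- q) ^+ a.
Proof.
move=> nz hc; have [p0|p0] := eqVneq p 0.
  have q0 : q != 0 by apply: contraNneq nz => ->; rewrite p0.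
  exists (c n / (- q) ^+ n) => a; rewrite leq_eqVlt => /orP[/eqP->|lt_an].
    by rewrite subnn expr0 mulr1 divfK // expf_neq0 // oppr_eq0.
  rewrite p0 expr0n subn_eq0 leqNgt lt_an mulr0 mul0r.
  by apply: (mulfI q0); rewrite mulr0 -(hc a lt_an) p0; ring.
exists (c 0 / p ^+ n); elim=> [|a IHa] lt_an.
  by rewrite subn0 expr0 mulr1 divfK // expf_neq0.
apply: (mulfI p0); have := hc a lt_an; rewrite (IHa (ltnW lt_an)).
move/eqP; rewrite addr_eq0 => /eqP ->.
rewrite -(subnSK lt_an) !exprS; ring.
Qed.

Definition quartic (P : nat -> C) (x y : C) :=
  P 0%N * y ^+ 4 + P 1%N * x * y ^+ 3 + P 2%N * x ^+ 2 * y ^+ 2 +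
  P 3%N * x ^+ 3 * y + P 4%N * x ^+ 4.

(** For c a functional on forms of degree 4 + j, its value at P x^k y^(j-k). *)
Definition contract (P c : nat -> C) k :=
  P 0%N * c k + P 1%N * c k.+1 + P 2%N * c k.+2 + P 3%N * c k.+3 +
  P 4%N * c k.+4.

Variables (P Q : nat -> C).
Hypothesis coprimePQ : forall x y, quartic P x y = 0 -> quartic Q x y = 0 ->
  (x, y) = 0.

(** By [annihilated_by_linear] c is a multiple of the evaluation at (-q, p).  It kills
    P x^k y^(j-k) and Q x^k y^(j-k), where P and Q are not both zero at this point,
    and neither are the monomials for k = 0 and k = j. *)
Lemma peel_linear_factor c j (p q : C) : (p, q) != 0 ->
  (forall a, (a < j + 4)%N -> p * c a.+1 + q * c a = 0) ->
  (forall k, (k <= j)%N -> contract P c k = 0 /\ contract Q c k = 0) ->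
  forall a, (a <= j + 4)%N -> c a = 0.
Proof.
move=> nz hc hPQ; have [l hl] := annihilated_by_linear nz hc.
suff l0 : l = 0 by move=> a /hl ->; rewrite l0 !mul0r.
apply/eqP; apply: contraNT (nz) => l0; apply/eqP.
have contractE (R : nat -> C) k : (k <= j)%N ->
    contract R c k = l * p ^+ (j - k) * (- q) ^+ k * quartic R (- q) p.
  move=> le_kj; rewrite /contract !hl; try lia.
  have e i : (i <= 4)%N -> (j + 4 - (i + k) = (j - k) + (4 - i))%N by lia.
  rewrite (e 0%N) // (e 1%N) // (e 2%N) // (e 3%N) // (e 4%N) //.
  rewrite /quartic !exprD !exprS; ring.
have zero k : (k <= j)%N -> p ^+ (j - k) * (- q) ^+ k != 0 -> (- q, p) = 0 :> C * C.
  move=> le_kj pq0; have [hP hQ] := hPQ k le_kj.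
  by apply: coprimePQ; [move: hP | move: hQ]; rewrite contractE // -(mulrA l);
    move/eqP; rewrite mulf_eq0 mulf_eq0 (negPf l0) (negPf pq0) => /eqP.
suff: (- q, p) = 0 :> C * C by move=> [/eqP]; rewrite oppr_eq0 => /eqP -> ->.
have [p0|p0] := eqVneq p 0; last by apply: (zero 0%N); rewrite ?mulr1 ?expf_neq0.
apply: (zero j) => //; rewrite subnn mul1r expf_neq0 // oppr_eq0.
by apply: contraNneq nz => ->; rewrite p0.
Qed.

(** A cubic h apolar to c splits into three linear factors.  The product of two of
    them contracted with c is killed by the third, so it is zero; the same argument
    then removes the second factor and the first, which leaves c = 0. *)
Lemma apolar_cubic_trivial c h :
  (forall k, (k <= 2)%N -> contract P c k = 0 /\ contract Q c k = 0) ->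
  (forall l, (l < 4)%N ->
     h 0%N * c l + h 1%N * c l.+1 + h 2%N * c l.+2 + h 3%N * c l.+3 = 0) ->
  (exists2 k, (k < 4)%N & h k != 0) ->
  forall a, (a <= 6)%N -> c a = 0.
Proof.
move=> hPQ hc [k lt_k4 hk0].
have [p1 [q1 [p2 [q2 [p3 [q3 [e3 e2 e1 e0]]]]]]] :=
  binary_cubic_factor (h 3%N) (h 2%N) (h 1%N) (h 0%N).
have nz1 : (p1, q1) != 0.
  apply: contraNneq hk0 => -[z1 z2]; move: e0 e1 e2 e3; rewrite z1 z2.
  by rewrite !mul0r !addr0; case: k lt_k4 => [|[|[|[|k]]]] // _ ? ? ? ?; apply/eqP.
have nz2 : (p2, q2) != 0.
  apply: contraNneq hk0 => -[z1 z2]; move: e0 e1 e2 e3; rewrite z1 z2.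
  by rewrite !mulr0 !mul0r !addr0; case: k lt_k4 => [|[|[|[|k]]]] // _ ? ? ? ?; apply/eqP.
have nz3 : (p3, q3) != 0.
  apply: contraNneq hk0 => -[z1 z2]; move: e0 e1 e2 e3; rewrite z1 z2.
  by rewrite !mulr0 !addr0; case: k lt_k4 => [|[|[|[|k]]]] // _ ? ? ? ?; apply/eqP.
pose D p q c a : C := p * c a.+1 + q * c a.
have DP (R : nat -> C) p q c' i : contract R c' i = 0 -> contract R c' i.+1 = 0 ->
    contract R (D p q c') i = 0.
  move=> h1 h2; transitivity (p * contract R c' i.+1 + q * contract R c' i).
    by rewrite /contract /D; ring.
  by rewrite h1 h2; ring.
have s2 : forall a, (a <= 0 + 4)%N -> D p2 q2 (D p3 q3 c) a = 0.
  apply: (@peel_linear_factor _ 0 p1 q1) => // [a lt_a|[|k'] // _].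
    rewrite -(hc a lt_a) e0 e1 e2 e3 /D; ring.
  have [P0 Q0] := hPQ 0%N isT; have [P1 Q1] := hPQ 1%N isT.
  have [P2 Q2] := hPQ 2 isT.
  by split; apply: (DP); apply: (DP).
have s1 : forall a, (a <= 1 + 4)%N -> D p3 q3 c a = 0.
  apply: (@peel_linear_factor _ 1 p2 q2) => // i le_i.
  have [P0 Q0] := hPQ i (leqW le_i).
  have [P1 Q1] := hPQ i.+1 le_i.
  by split; apply: DP.
by apply: (@peel_linear_factor _ 2 p3 q3).
Qed.

End Apolarity.

(** * Hankel form of a determinantal cubic through a twisted cubic *)

Section Hankel.
Variable C : numClosedFieldType.
Implicit Types (X U : nat -> C).

Lemma wide_left_kernel m n (A : 'M[C]_(m, n)) : (n < m)%N ->
  exists2 v : 'rV_m, v != 0 & v *m A = 0.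
Proof.
move=> lt_nm; exists (nz_row (kermx A)); last exact/sub_kermxP/nz_row_sub.
by rewrite nz_row_eq0 -mxrank_eq0 mxrank_ker subn_eq0 -ltnNge
  (leq_ltn_trans (rank_leq_col A)).
Qed.

Lemma singular_left_kernel n (A : 'M[C]_n) : A \notin unitmx ->
  exists2 v : 'rV_n, v != 0 & v *m A = 0.
Proof.
by rewrite unitmxE unitfE negbK => /det0P[v v0 vA]; exists v.
Qed.

Definition det3 (a b c d e f g h i : C) : C :=
  a * (e * i - f * h) - b * (d * i - f * g) + c * (d * h - e * g).

Definition lin4 (a X : nat -> C) : C :=
  a 0%N * X 0%N + a 1%N * X 1%N + a 2%N * X 2%N + a 3%N * X 3%N.

Variable m : nat -> nat -> C.

(** The first two columns are proportional along the twisted cubic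
    X_l = x^l y^(3-l), so that the surface contains this curve. *)
Definition scroll_cubic X : C :=
  det3 (X 0%N) (X 1%N) (lin4 (m 0) X) (X 1%N) (X 2%N) (lin4 (m 1) X)
       (X 2%N) (X 3%N) (lin4 (m 2) X).

(* The expression is twice the value at U of the derivative of the cubic at X. *)
Hypothesis smooth_scroll : forall X, (exists2 l, (l < 4)%N & X l != 0) ->
  exists U, scroll_cubic (fun l => X l + U l) - scroll_cubic (fun l => X l - U l)
    - 2%:R * scroll_cubic U != 0.

(* P i is x m_i - y m_(i+1) restricted to X_l = x^l y^(3-l). *)
Let P i a : C := (if a is l.+1 then m i l else 0) - (if a is 4 then 0 else m i.+1 a).

(** At a common zero (x, y) the third column is proportional to (y^2, xy, x^2), as
    are the first two at the point X_l = x^l y^(3-l).  There the matrix has rank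
    one, and its determinant vanishes to second order. *)
Lemma quartics_coprime x y :
  quartic (P 0) x y = 0 -> quartic (P 1) x y = 0 -> (x, y) = 0.
Proof.
move=> P0 P1; apply/eqP/negP => /negP nz.
pose X l := x ^+ l * y ^+ (3 - l).
have e0 : x * lin4 (m 0) X = y * lin4 (m 1) X.
  by apply/eqP; rewrite -subr_eq0 -P0; apply/eqP; rewrite /quartic /P /lin4 /X /=; ring.
have e1 : x * lin4 (m 1) X = y * lin4 (m 2) X.
  by apply/eqP; rewrite -subr_eq0 -P1; apply/eqP; rewrite /quartic /P /lin4 /X /=; ring.
have [k [k0 k1 k2]] : exists k, [/\ lin4 (m 0) X = k * y ^+ 2,
    lin4 (m 1) X = k * (x * y) & lin4 (m 2) X = k * x ^+ 2].
  have [y0|y0] := eqVneq y 0.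
    have x0 : x != 0 by apply: contraNneq nz => ->; rewrite y0.
    exists (lin4 (m 2) X / x ^+ 2); move: e0 e1; rewrite y0 !mul0r.
    move=> /eqP; rewrite mulf_eq0 (negPf x0) /= => /eqP ->.
    move=> /eqP; rewrite mulf_eq0 (negPf x0) /= => /eqP ->.
    by split; [ring | ring | field].
  exists (lin4 (m 0) X / y ^+ 2); split; first by field.
    by apply: (mulfI y0); rewrite -e0; field.
  by apply: (mulfI (expf_neq0 2 y0)); rewrite [in LHS]expr2 -mulrA -e1 mulrCA -e0; field.
have [|U] := smooth_scroll (X := X).
  have [y0|y0] := eqVneq y 0; last by exists 0%N; rewrite // /X mul1r expf_neq0.
  exists 3%N => //; rewrite /X mulr1 expf_neq0 //.
  by apply: contraNneq nz => ->; rewrite y0.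
case/eqP.
have linD : forall i, lin4 (m i) (fun l => X l + U l) = lin4 (m i) X + lin4 (m i) U.
  by move=> i; rewrite /lin4; ring.
have linB : forall i, lin4 (m i) (fun l => X l - U l) = lin4 (m i) X - lin4 (m i) U.
  by move=> i; rewrite /lin4; ring.
rewrite /scroll_cubic !linD !linB k0 k1 k2 /X /= /det3; ring.
Qed.

(** That the third column becomes Hankel too, with entries e, amounts to six linear
    equations on c_0, .., c_6.  A vector h in the kernel of the Hankel matrix of a
    solution c is a cubic apolar to c. *)
Lemma hankelization : exists c e : nat -> C,
  (\matrix_(l < 4, k < 4) c (l + k)%N) \in unitmx /\
  forall i k, (i < 3)%N -> (k < 4)%N -> lin4 (m i) (fun l => c (l + k)%N) = e (i + k)%N.
Proof.
pose E : 'M[C]_(7, 6) := \matrix_(s, t)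
  (let i := (t %/ 3)%N in let k := (t %% 3)%N in
   if (k <= s)%N && (s <= k + 4)%N then P i (s - k)%N else 0).
have [v v0 vE] := wide_left_kernel E isT.
pose c a : C := if (a < 7)%N then v 0 (inord a) else 0.
have cv (s : 'I_7) : v 0 s = c s by rewrite /c ltn_ord inord_val.
have vE' (t : 'I_6) : \sum_(s < 7) c s * E s t = 0.
  by have /rowP/(_ t) := vE; rewrite !mxE; under eq_bigr do rewrite cv.
have cE k : (k <= 2)%N -> contract (P 0) c k = 0 /\ contract (P 1) c k = 0.
  have tot (t : 'I_6) := vE' t; rewrite /E in tot.
  by case: k => [|[|[|k]]] // _; split;
    [rewrite -(tot (inord 0)) | rewrite -(tot (inord 3)) | rewrite -(tot (inord 1))
    | rewrite -(tot (inord 4)) | rewrite -(tot (inord 2)) | rewrite -(tot (inord 5))];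
    rewrite !big_ord_recr big_ord0 !mxE inordK //= /contract ?subn0 ?subSS; ring.
exists c, (fun a => if (a <= 3)%N then lin4 (m 0) (fun l => c (l + a)%N)
             else if a == 4%N then lin4 (m 1) (fun l => c (l + 3)%N)
             else lin4 (m 2) (fun l => c (l + 3)%N)).
have shift i k : (i < 2)%N -> (k < 3)%N ->
    lin4 (m i) (fun l => c (l + k.+1)%N) = lin4 (m i.+1) (fun l => c (l + k)%N).
  move=> lt_i2 lt_k3; apply/eqP; rewrite -subr_eq0; apply/eqP.
  have [h0 h1] := cE k lt_k3.
  by case: i lt_i2 => [|[|i]] // _; [rewrite -h0 | rewrite -h1];
    rewrite /contract /lin4 /P !addSn !add0n; ring.
split; last first.
  move=> i k; case: i => [|[|[|i]]] // _; case: k => [|[|[|[|k]]]] // _ //=;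
    by rewrite ?(shift 0%N) ?(shift 1%N).
apply/negPn/negP => /singular_left_kernel [h h0 hH].
have c0 a : (a <= 6)%N -> c a = 0.
  apply: (@apolar_cubic_trivial _ _ _ quartics_coprime c
    (fun k => if (k < 4)%N then h 0 (inord k) else 0) cE) => [l lt_l4|].
    have /rowP/(_ (Ordinal lt_l4)) := hH; rewrite !mxE => <-.
    rewrite !big_ord_recr big_ord0 /= !mxE /= add0r ?add0n ?addSn.
    by do 4?[congr (_ + _)]; congr (h 0 _ * _); apply: val_inj; rewrite /= inordK.
  have [k hk] : exists k, h 0 k != 0.
    apply/existsP; apply: contraNT h0; rewrite negb_exists => /forallP hh.
    by apply/eqP/rowP => k; rewrite mxE; apply/eqP; rewrite -[_ == _]negbK hh.
  by exists k; rewrite ?ltn_ord // inord_val.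
case/eqP: v0; apply/rowP => s; rewrite cv c0 ?mxE //; by rewrite -ltnS.
Qed.

End Hankel.

(** * Leading terms and resultants *)

Section LeadingTerm.
Variable C : numClosedFieldType.
Implicit Types p q : {poly C}.

(** Here n only bounds the degree, and c may be zero; this makes the notion stable
    under sums and products. *)
Definition has_lead p n c := (size p <= n.+1)%N /\ p`_n = c.

Lemma has_leadD p q n c d :
  has_lead p n c -> has_lead q n d -> has_lead (p + q) n (c + d).
Proof.
move=> [sp <-] [sq <-]; split; last by rewrite coefD.
by rewrite (leq_trans (size_polyD _ _)) // geq_max sp.
Qed.

Lemma has_leadN p n c : has_lead p n c -> has_lead (- p) n (- c).
Proof. by move=> [sp <-]; split; rewrite ?size_polyN // coefN. Qed.

Lemma has_leadB p q n c d :
  has_lead p n c -> has_lead q n d -> has_lead (p - q) n (c - d).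
Proof. by move=> hp /has_leadN; apply: has_leadD. Qed.

Lemma has_leadM p q n k c d :
  has_lead p n c -> has_lead q k d -> has_lead (p * q) (n + k) (c * d).
Proof.
move=> [sp <-] [sq <-]; split.
  rewrite (leq_trans (size_polyMleq _ _)) //.
  by rewrite -subn1 leq_subLR add1n -addnS -addSn leq_add.
rewrite coefM.
have lt_n : (n < (n + k).+1)%N by rewrite ltnS leq_addr.
rewrite (bigD1 (Ordinal lt_n)) //= addKn big1 ?addr0 // => i ne_in.
have [lt_in|le_ni] := ltnP i n.
  by rewrite [q`_ _]nth_default ?mulr0 //; apply: leq_trans sq _; lia.
rewrite nth_default ?mul0r //; apply: leq_trans sp _.
by rewrite ltn_neqAle le_ni andbT eq_sym -val_eqE in ne_in *.
Qed.

Lemma has_leadC c : has_lead c%:P 0 c.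
Proof. by split; rewrite ?coefC // size_polyC leq_b1. Qed.

Lemma has_leadX : has_lead 'X 1 1.
Proof. by split; rewrite ?coefX // size_polyX. Qed.

Lemma has_lead_low p n k c : has_lead p k c -> (k < n)%N -> has_lead p n 0.
Proof.
move=> [sp _] lt_kn; split; first by rewrite (leq_trans sp) // ltnW.
by rewrite nth_default // (leq_trans sp).
Qed.

Lemma has_lead_root p n c : has_lead p n c -> (0 < n)%N -> c != 0 ->
  exists x, root p x.
Proof.
move=> [_ <-] n0 pn; apply: closed_root_size.
by rewrite ltnNge; apply: contra pn => sp; rewrite nth_default // (leq_trans sp).
Qed.

Lemma has_lead_roots p n c : has_lead p n c -> c != 0 ->
  exists s : seq C, forall x, root p x -> x \in s.
Proof.
move=> [_ <-] pn; have [s ->] := closed_field_poly_normal p.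
exists s => x; rewrite rootZ ?root_prod_XsubC // lead_coef_eq0.
by apply: contraNneq pn => ->; rewrite coef0.
Qed.

Lemma exists_notin (s : seq C) : exists x, x \notin s.
Proof.
exists (1 + \sum_(r <- s) `|r|); apply/negP => xs.
have: `|1 + \sum_(r <- s) `|r| | <= \sum_(r <- s) `|r|.
  rewrite [leRHS](big_rem _ xs) /= lerDl; exact: sumr_ge0.
have sum0 : 0 <= \sum_(r <- s) `|r| by apply: sumr_ge0.
by rewrite ger0_norm ?addr_ge0 // gerDr ler10.
Qed.

End LeadingTerm.

Section DetLead.
Variable C : numClosedFieldType.
Implicit Types p q : {poly C}.

Lemma has_leadDl p q n k c d : has_lead p n c -> has_lead q k d -> (k < n)%N ->
  has_lead (p + q) n c.
Proof.
by move=> hp hq lt_kn; rewrite -(addr0 c); apply: has_leadD hp (has_lead_low hq lt_kn).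
Qed.

Lemma has_leadZ a p n c : has_lead p n c -> has_lead (a%:P * p) n (a * c).
Proof. exact: has_leadM (has_leadC a). Qed.

Lemma has_lead_sum I (r : seq I) (F : I -> {poly C}) (G : I -> C) n :
  (forall i, has_lead (F i) n (G i)) ->
  has_lead (\sum_(i <- r) F i) n (\sum_(i <- r) G i).
Proof.
move=> h; elim: r => [|i r IHr]; last by rewrite !big_cons; apply: has_leadD.
by rewrite !big_nil; split; rewrite ?size_poly0 ?coef0.
Qed.

Lemma has_lead_prod I (r : seq I) (F : I -> {poly C}) (G : I -> C) n :
  (forall i, has_lead (F i) n (G i)) ->
  has_lead (\prod_(i <- r) F i) (size r * n) (\prod_(i <- r) G i).
Proof.
move=> h; elim: r => [|i r IHr]; last by rewrite !big_cons mulSn; apply: has_leadM.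
by rewrite !big_nil mul0n; apply: has_leadC.
Qed.

Lemma has_lead_det k (M : 'M[{poly C}]_k) (N : 'M[C]_k) n :
  (forall i j, has_lead (M i j) n (N i j)) -> has_lead (\det M) (k * n) (\det N).
Proof.
move=> h; apply: has_lead_sum => s.
set e := nat_of_bool _.
have -> : (-1) ^+ e = ((-1) ^+ e)%:P :> {poly C} by rewrite rmorphXn rmorphN1.
apply: has_leadZ; rewrite -[k in (k * n)%N]card_ord cardE enumT.
by rewrite -[Finite.enum _]/(index_enum _); apply: has_lead_prod => i; apply: h.
Qed.

End DetLead.

Section Resultant.
Variable R : comNzRingType.

(** The resultant of two binary forms of degrees two and three. *)
Definition res23 (b2 b1 b0 c3 c2 c1 c0 : R) : R :=
  c3 * c3 * (b0 * b0 * b0) - c3 * c2 * (b0 * b0 * b1)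
  + c3 * c1 * (b0 * (b1 * b1 - 2%:R * (b0 * b2)))
  - c3 * c0 * (b1 * b1 * b1 - 3%:R * (b1 * b0 * b2))
  + c2 * c2 * (b0 * b0 * b2) - c2 * c1 * (b0 * b1 * b2)
  + c2 * c0 * (b2 * (b1 * b1 - 2%:R * (b0 * b2)))
  + c1 * c1 * (b0 * b2 * b2) - c1 * c0 * (b1 * b2 * b2) + c0 * c0 * (b2 * b2 * b2).
End Resultant.

Section CommonZero.
Variable C : numClosedFieldType.

Lemma res23_zero (b2 b1 b0 c3 c2 c1 c0 : C) : res23 b2 b1 b0 c3 c2 c1 c0 = 0 ->
  exists x y, [/\ (x, y) != 0, b2 * x ^+ 2 + b1 * x * y + b0 * y ^+ 2 = 0 &
    c3 * x ^+ 3 + c2 * x ^+ 2 * y + c1 * x * y ^+ 2 + c0 * y ^+ 3 = 0].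
Proof.
have [p [q [r [s [-> -> ->]]]]] := binary_quadratic_factor b2 b1 b0.
have [x [y [xy xyC]]] := binary_cubic_zero c3 c2 c1 c0.
have [[-> ->] _|pq] := eqVneq (p, q) 0.
  by exists x, y; split=> //; ring.
have [[-> ->] _|rs] := eqVneq (r, s) 0.
  by exists x, y; split=> //; ring.
move=> e.
have /eqP : (c3 * q ^+ 3 - c2 * q ^+ 2 * p + c1 * q * p ^+ 2 - c0 * p ^+ 3) *
   (c3 * s ^+ 3 - c2 * s ^+ 2 * r + c1 * s * r ^+ 2 - c0 * r ^+ 3) = 0.
  by rewrite -[RHS]e /res23; ring.
rewrite mulf_eq0 => /orP[] /eqP h.
  exists q, (- p); split; [|ring|by rewrite -[RHS]h; ring].
  by apply: contraNneq pq => -[-> /eqP]; rewrite oppr_eq0 => /eqP ->.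
exists s, (- r); split; [|ring|by rewrite -[RHS]h; ring].
by apply: contraNneq rs => -[-> /eqP]; rewrite oppr_eq0 => /eqP ->.
Qed.

Lemma horner_res23 (b2 b1 b0 c3 c2 c1 c0 : {poly C}) a :
  (res23 b2 b1 b0 c3 c2 c1 c0).[a] =
  res23 b2.[a] b1.[a] b0.[a] c3.[a] c2.[a] c1.[a] c0.[a].
Proof. by rewrite /res23 -!polyC_natr !hornerE /=; ring. Qed.

(** The resultant is isobaric: if the coefficient of x^i y^j has degree at most
    1 + 4 j in the quadratic form and 4 j in the cubic form, then the resultant has
    degree at most 27, the number of lines on the surface. *)
Lemma has_lead_res23 (b2 b1 b0 c3 c2 c1 c0 : {poly C}) (B2 B1 B0 C3 C2 C1 C0 : C) :
  has_lead b2 1 B2 -> has_lead b1 5 B1 -> has_lead b0 9 B0 ->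
  has_lead c3 0 C3 -> has_lead c2 4 C2 -> has_lead c1 8 C1 -> has_lead c0 12 C0 ->
  has_lead (res23 b2 b1 b0 c3 c2 c1 c0) 27 (res23 B2 B1 B0 C3 C2 C1 C0).
Proof.
move=> l2 l1 l0 k3 k2 k1 k0.
have n2 : has_lead (2%:R : {poly C}) 0 2%:R by rewrite -polyC_natr; apply: has_leadC.
have n3 : has_lead (3%:R : {poly C}) 0 3%:R by rewrite -polyC_natr; apply: has_leadC.
have l02 := has_leadM l0 l2; have l11 := has_leadM l1 l1.
have l00 := has_leadM l0 l0.
have t := has_leadB l11 (has_leadM n2 l02).
have r1 := has_leadM (has_leadM k3 k3) (has_leadM l00 l0).
have r2 := has_leadM (has_leadM k3 k2) (has_leadM l00 l1).
have r3 := has_leadM (has_leadM k3 k1) (has_leadM l0 t).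
have r4 := has_leadM (has_leadM k3 k0)
  (has_leadB (has_leadM l11 l1) (has_leadM n3 (has_leadM (has_leadM l1 l0) l2))).
have r5 := has_leadM (has_leadM k2 k2) (has_leadM l00 l2).
have r6 := has_leadM (has_leadM k2 k1) (has_leadM (has_leadM l0 l1) l2).
have r7 := has_leadM (has_leadM k2 k0) (has_leadM l2 t).
have r8 := has_leadM (has_leadM k1 k1) (has_leadM l02 l2).
have r9 := has_leadM (has_leadM k1 k0) (has_leadM (has_leadM l1 l2) l2).
have r0 := has_leadM (has_leadM k0 k0) (has_leadM (has_leadM l2 l2) l2).
exact: has_leadD (has_leadB (has_leadD (has_leadD (has_leadB (has_leadD (has_leadB
  (has_leadD (has_leadB r1 r2) r3) r4) r5) r6) r7) r8) r9) r0.
Qed.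

End CommonZero.

(** * Pencils of matrices and twisted cubics *)

Section Kronecker.
Variable C : numClosedFieldType.

Lemma unitmx_kernel n (A : 'M[C]_n) :
  (forall v : 'rV_n, v *m A = 0 -> v = 0) -> A \in unitmx.
Proof.
move=> h; apply/negPn/negP => /singular_left_kernel[v /eqP v0 /h]; exact: v0.
Qed.

Lemma eigenvector n (A : 'M[C]_n.+1) :
  exists2 v : 'rV_n.+1, v != 0 & exists a, v *m A = a *: v.
Proof.
have [a] : exists a, root (char_poly A) a.
  by apply: closed_root_size; rewrite size_char_poly.
rewrite -eigenvalue_root_char => /eigenvalueP[v hv v0].
by exists v => //; exists a.
Qed.

(** This is the generic case of Kronecker's normal form.  The vectors z for which
    z N2 lies in the row space of N1 form the kernel of a linear form lambda, and
    on it N2 = G N1 for an endomorphism G.  Injectivity of the pencil says that G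
    has no eigenvector killed by lambda.  Hence a vector z0 killed by lambda and by
    G lambda is cyclic for G, and the rows of Z are z0, z0 G and z0 G^2. *)
Lemma kronecker_pencil (N1 N2 : 'M[C]_(3, 4)) :
  (forall s1 s2 (z : 'rV_3), (s1, s2) != 0 -> z *m (s1 *: N1 + s2 *: N2) = 0 ->
     z = 0) ->
  exists Z : 'M_3, [/\ Z \in unitmx,
    row 0 Z *m N2 = row 1 Z *m N1, row 1 Z *m N2 = row 2%:R Z *m N1 &
    col_mx (Z *m N1) (row 2%:R Z *m N2) \in unitmx].
Proof.
move=> inj.
have inj1 (z : 'rV_3) : z *m N1 = 0 -> z = 0.
  move=> h; apply: (inj 1 0); first by rewrite xpair_eqE oner_eq0.
  by rewrite scale1r scale0r addr0.
have noeig (z : 'rV_3) r : z *m N2 = r *: (z *m N1) -> z = 0.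
  move=> h; apply: (inj (- r) 1); first by rewrite xpair_eqE oner_eq0 andbF.
  by rewrite scale1r mulmxDr h -scalemxAr scaleNr addNr.
have free1 : row_free N1.
  rewrite -kermx_eq0; apply/eqP/row_matrixP => i; rewrite row0; apply: inj1.
  by apply/sub_kermxP/row_sub.
(* eta spans the annihilator of the row space of N1, so that lambda tells
   which z have z N2 in this row space; G expresses z N2 there. *)
have [eta eta0 N1eta] : exists2 eta : 'cV_4, eta != 0 & N1 *m eta = 0.
  have [v v0 vN] := wide_left_kernel N1^T isT.
  by exists v^T; rewrite ?trmx_eq0 // -(trmxK N1) -trmx_mul vN trmx0.
have subN1 (y : 'rV_4) : y *m eta = 0 -> (y <= N1)%MS.
  move=> yeta; have N1ker : (N1 <= kermx eta)%MS by apply/sub_kermxP.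
  apply: submx_trans (_ : (kermx eta <= N1)%MS); first exact/sub_kermxP.
  rewrite -(geq_leqif (mxrank_leqif_sup N1ker)) mxrank_ker (eqP free1).
  by move: eta0; rewrite -mxrank_eq0; case: (\rank eta) => // k _; rewrite subSS leq_subr.
pose G := N2 *m pinvmx N1; pose lam := N2 *m eta.
have GE (z : 'rV_3) : z *m lam = 0 -> z *m N2 = z *m G *m N1.
  by rewrite mulmxA => /subN1 h; rewrite /G mulmxA mulmxKpV.
have noGeig (z : 'rV_3) r : z *m lam = 0 -> z *m G = r *: z -> z = 0.
  by move=> zlam zG; apply: (noeig z r); rewrite GE // zG scalemxAl.
have [z0 z0n0 z0E] := wide_left_kernel (row_mx lam (G *m lam)) isT.
move: z0E; rewrite mul_mx_row -[0]row_mx0 => /eq_row_mx[z0lam z0Glam].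
pose z1 := z0 *m G; pose z2 := z1 *m G.
have z1lam : z1 *m lam = 0 by rewrite -mulmxA.
have lin_dep p q (w : 'rV_3) : w *m lam = 0 -> p *: (w *m G) + q *: w = 0 ->
    w = 0 \/ p = 0 /\ q = 0.
  move=> wlam e; have [p0|p0] := eqVneq p 0; [have [q0|q0] := eqVneq q 0 |].
  - by right.
  - left; apply: (scalerI q0); rewrite scaler0 -e p0 scale0r add0r //.
  left; apply: (noGeig w (- (q / p))) => //; apply: (scalerI p0).
  rewrite scalerA mulrN mulrCA divff // mulr1 scaleNr.
  by apply/eqP; rewrite -addr_eq0 e.
have indep a b c : a *: z0 + b *: z1 + c *: z2 = 0 -> [/\ a = 0, b = 0 & c = 0].
  have [p [q [r [s [-> -> ->]]]]] := binary_quadratic_factor c b a => e.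
  have e' : p *: ((r *: z1 + s *: z0) *m G) + q *: (r *: z1 + s *: z0) = 0.
    have E (x y z : 'rV[C]_3) : p *: (r *: z + s *: y) + q *: (r *: y + s *: x) =
        (q * s) *: x + (p * s + q * r) *: y + (p * r) *: z.
      by apply/rowP => k; rewrite !mxE; ring.
    by rewrite -e mulmxDl -!scalemxAl E.
  have [|w0|[-> ->]] := lin_dep _ _ _ _ e'; last by rewrite !mul0r addr0.
    by rewrite mulmxDl -!scalemxAl z1lam z0lam !scaler0 addr0.
  have [/eqP z00|[-> ->]] := lin_dep r s z0 z0lam w0; last by rewrite !mulr0 addr0.
  by rewrite (negPf z0n0) in z00.
pose Z : 'M_3 := \matrix_(i < 3) nth 0 [:: z0; z1; z2] i.
have [r0 r1 r2] : [/\ row 0 Z = z0, row 1 Z = z1 & row 2%:R Z = z2].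
  by split; rewrite rowK.
have Zu : Z \in unitmx.
  apply: unitmx_kernel => v; rewrite mulmx_sum_row !big_ord_recr big_ord0 /= add0r.
  rewrite !rowK /= => /indep[v0 v1 v2]; apply/rowP => i; rewrite mxE.
  by case: i => -[|[|[|//]]] hi; [rewrite -[RHS]v0 | rewrite -[RHS]v1 | rewrite -[RHS]v2];
    congr (v _ _); apply: val_inj.
have z2lam : z2 *m lam != 0.
  apply/eqP => z2lam.
  have Zlam : Z *m lam = 0.
    apply/row_matrixP => i; rewrite row_mul rowK row0.
    by case: (i : nat) (ltn_ord i) => [|[|[|k]]].
  have lam0 : lam = 0 by rewrite -(mulKmx Zu lam) Zlam mulmx0.
  have [w w0 [r wG]] := eigenvector G.
  by case/eqP: w0; apply: (noGeig w r); rewrite // lam0 mulmx0.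
exists Z; rewrite r0 r1 r2 (GE z0) ?(GE z1) //; split=> //.
apply: (@unitmx_kernel (3 + 1)) => v; rewrite -[v]hsubmxK.
set u := lsubmx v; set t := rsubmx v.
rewrite mul_row_col => e.
have t0 : t = 0.
  have := congr1 (mulmx^~ eta) e; rewrite mulmxDl mul0mx -(mulmxA u) -(mulmxA Z).
  rewrite N1eta !mulmx0 add0r -(mulmxA t) -(mulmxA z2).
  rewrite (mx11_scalar t) -/lam mul_scalar_mx => /eqP.
  by rewrite scaler_eq0 (negPf z2lam) orbF => /eqP ->; rewrite raddf0.
move: e; rewrite t0 mul0mx addr0 mulmxA => /inj1 uZ.
by rewrite -(mulmxK Zu u) uZ mul0mx row_mx0.
Qed.

End Kronecker.

Section Scroll.
Variable C : numClosedFieldType.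

Lemma sum_ord4 (V : nmodType) (g : 'I_4 -> V) :
  \sum_j g j = g (inord 0) + g (inord 1) + g (inord 2) + g (inord 3).
Proof.
rewrite !big_ord_recr big_ord0 /= add0r.
by do ?congr (_ + _); congr g; apply: val_inj; rewrite /= inordK.
Qed.

Lemma sum_ord3 (V : nmodType) (g : 'I_3 -> V) : \sum_j g j = g 0 + g 1 + g 2%:R.
Proof.
rewrite !big_ord_recr big_ord0 /= add0r.
by do ?congr (_ + _); congr g; apply: val_inj.
Qed.

Lemma det_mx33 (A : 'M[C]_3) : \det A =
  det3 (A 0 0) (A 0 1) (A 0 2%:R) (A 1 0) (A 1 1) (A 1 2%:R)
       (A 2%:R 0) (A 2%:R 1) (A 2%:R 2%:R).
Proof.
pose B i j := A (inord i) (inord j).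
have -> : A = \matrix_(i < 3, j < 3) B i j.
  by apply/matrixP => i j; rewrite mxE /B !inord_val.
rewrite (expand_det_row _ 0) !big_ord_recr big_ord0 /= add0r /cofactor.
rewrite !(expand_det_row _ 0) !big_ord_recr !big_ord0 /= !add0r /cofactor.
rewrite !det_mx11 !mxE /= /det3 /bump /=; ring.
Qed.

(** The rows of A i are the linear forms in row i of a 3 x 3 matrix. *)
Definition pencil_cubic (A : nat -> 'M[C]_(3, 4)) (v : 'cV[C]_4) : C :=
  \det (\matrix_(i < 3, k < 3) (A i *m v) k 0).

(** In Kronecker's basis of the columns, the first two rows of the matrix become
    (X_0, X_1, X_2) and (X_1, X_2, X_3), with independent X_l. *)
Lemma scroll_of_pencil (A : nat -> 'M[C]_(3, 4)) :
  (forall s1 s2 (z : 'rV_3), (s1, s2) != 0 -> z *m (s1 *: A 0 + s2 *: A 1) = 0 ->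
     z = 0) ->
  exists (k : C) (X : 'M[C]_4) mu, [/\ k != 0, X \in unitmx & forall v,
    pencil_cubic A v = k * scroll_cubic mu (fun l => (X *m v) (inord l) 0)].
Proof.
case/kronecker_pencil => Z [Zu e01 e12 Xu].
pose X : 'M[C]_(3 + 1, 4) := col_mx (Z *m A 0) (row 2%:R Z *m A 1); rewrite -/X in Xu.
exists (\det Z)^-1, X, (fun k l => (Z *m A 2 *m invmx X) (inord k) (inord l)).
split=> //; first by rewrite invr_eq0 -unitfE -unitmxE.
move=> v; apply: (mulIf (_ : \det Z != 0)); first by rewrite -unitfE -unitmxE.
rewrite mulrAC mulVf ?mul1r; last by rewrite -unitfE -unitmxE.
rewrite -[\det Z]det_tr /pencil_cubic -det_mulmx.
pose Y l := (X *m v) (inord l : 'I_(3 + 1)) 0.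
have XE i : (i < 3)%N -> (Z *m A 0 *m v) (inord i) 0 = Y i.
  move=> lt_i3; rewrite /Y /X mul_col_mx.
  have -> : inord i = lshift 1 (inord i : 'I_3) :> 'I_4.
    by apply: val_inj; rewrite /= !inordK // ltnW.
  by rewrite col_mxEu.
have rowE (B : 'M[C]_(3, 4)) i : (Z *m B *m v) i 0 = (row i Z *m B *m v) 0 0.
  by rewrite -!row_mul [RHS]mxE.
have Y3 : (Z *m A 1%N *m v) 2%:R 0 = Y 3%N.
  rewrite rowE /Y /X mul_col_mx.
  have -> : inord 3 = rshift 3 (0 : 'I_1) :> 'I_(3 + 1) by apply: val_inj; rewrite /= inordK.
  by rewrite col_mxEd.
have Z0 : (Z *m A 1%N *m v) 0 0 = Y 1%N.
  by rewrite rowE e01 -rowE -XE //; congr ((_ *m _) _ _); apply: val_inj; rewrite /= inordK.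
have Z1 : (Z *m A 1%N *m v) 1 0 = Y 2%N.
  by rewrite rowE e12 -rowE -XE //; congr ((_ *m _) _ _); apply: val_inj; rewrite /= inordK.
have [i0 i1 i2] : [/\ inord 0 = 0 :> 'I_3, inord 1 = 1 :> 'I_3 & inord 2 = 2%:R :> 'I_3].
  by split; apply: val_inj; rewrite /= inordK.
have mE i : (i < 3)%N -> (Z *m A 2%N *m v) (inord i) 0 =
    lin4 (fun l => (Z *m A 2%N *m invmx X) (inord i) (inord l)) Y.
  move=> lt_i3; rewrite -[in LHS](mulmxKV Xu (Z *m A 2%N)) -(mulmxA _ X v) mxE.
  by rewrite sum_ord4.
have entry (i k : 'I_3) : ((\matrix_(i < 3, k < 3) (A i *m v) k 0) *m Z^T) i k =
    (Z *m A i *m v) k 0.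
  by rewrite -mulmxA !mxE; apply: eq_bigr => j _; rewrite !mxE mulrC.
have X0 := XE 0%N isT; have X1 := XE 1%N isT; have X2 := XE 2 isT.
have m0 := mE 0%N isT; have m1 := mE 1%N isT; have m2 := mE 2 isT.
rewrite i0 in X0 m0; rewrite i1 in X1 m1; rewrite i2 in X2 m2.
rewrite det_mx33 !entry /= X0 X1 X2 Z0 Z1 Y3 m0 m1 m2 /scroll_cubic i0 i1 i2 /det3.
rewrite /Y; ring.
Qed.
End Scroll.

Section Chain.
Variable C : numClosedFieldType.

(** Elimination of z and y: the first two equations determine z by Cramer's rule,
    up to a factor, as a vector of quadratic polynomials in x, and the last two
    then give one equation in x, of degree four and leading coefficient c3.  Its
    product with Z3 vanishes also where Cramer's rule does not apply. *)
Lemma degenerate_coordinate_finite (a1 b1 c1 a2 b2 c2 a3 b3 c3 a4 b4 c4 : C) : c3 != 0 ->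
  exists s : seq C, forall x y z1 z2 z3 : C, (z1, z2, z3) != 0 ->
    (x + a1) * z1 + b1 * z2 + c1 * z3 = 0 ->
    a2 * z1 + (x + b2) * z2 + c2 * z3 = 0 ->
    a3 * z1 + (y + b3) * z2 + c3 * z3 = 0 ->
    a4 * z1 + b4 * z2 + (y + c4) * z3 = 0 -> x \in s.
Proof.
move=> c3n0.
pose X1 : {poly C} := 'X + a1%:P; pose X2 : {poly C} := 'X + b2%:P.
pose Z1 := b1%:P * c2%:P - c1%:P * X2; pose Z2 := c1%:P * a2%:P - c2%:P * X1.
pose Z3 := X1 * X2 - b1%:P * a2%:P.
pose S a b c := a%:P * Z1 + b%:P * Z2 + c%:P * Z3.
have lX1 : has_lead X1 1 1.
  have := has_leadD (has_leadX C) (has_lead_low (has_leadC a1) (ltn0Sn 0)).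
  by rewrite addr0.
have lX2 : has_lead X2 1 1.
  have := has_leadD (has_leadX C) (has_lead_low (has_leadC b2) (ltn0Sn 0)).
  by rewrite addr0.
have lCC a b : has_lead (a%:P * b%:P : {poly C}) 2 0.
  exact: has_lead_low (has_leadM (has_leadC a) (has_leadC b)) _.
have lZ1 : has_lead Z1 2 0.
  have := has_leadB (lCC b1 c2) (has_lead_low (has_leadM (has_leadC c1) lX2) (leqnn 2)).
  by rewrite subr0.
have lZ2 : has_lead Z2 2 0.
  have := has_leadB (lCC c1 a2) (has_lead_low (has_leadM (has_leadC c2) lX1) (leqnn 2)).
  by rewrite subr0.
have lZ3 : has_lead Z3 2 1.
  by have := has_leadB (has_leadM lX1 lX2) (lCC b1 a2); rewrite mulr1 subr0.
have lS a b c : has_lead (S a b c) 2 c.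
  have := has_leadD (has_leadD (has_leadM (has_leadC a) lZ1)
    (has_leadM (has_leadC b) lZ2)) (has_leadM (has_leadC c) lZ3).
  by rewrite !mulr0 !add0r mulr1.
pose E := Z3 * (Z3 * S a3 b3 c3 - Z2 * S a4 b4 c4).
have lE : has_lead E 6 c3.
  have := has_leadM lZ3 (has_leadB (has_leadM lZ3 (lS a3 b3 c3))
    (has_leadM lZ2 (lS a4 b4 c4))).
  by rewrite !mul1r mul0r subr0.
have [s hs] := has_lead_roots lE c3n0.
exists s => x y z1 z2 z3 nz e1 e2 e3 e4; apply: hs.
(* Cramer's rule on the first two equations *)
pose w1 := b1 * c2 - c1 * (x + b2); pose w2 := c1 * a2 - c2 * (x + a1).
pose w3 := (x + a1) * (x + b2) - b1 * a2.
have c13 : w3 * z1 = w1 * z3.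
  apply/eqP; rewrite -subr_eq0; apply/eqP; transitivity
    ((x + b2) * ((x + a1) * z1 + b1 * z2 + c1 * z3) -
     b1 * (a2 * z1 + (x + b2) * z2 + c2 * z3)); first by rewrite /w1 /w3; ring.
  by rewrite e1 e2; ring.
have c23 : w3 * z2 = w2 * z3.
  apply/eqP; rewrite -subr_eq0; apply/eqP; transitivity
    ((x + a1) * (a2 * z1 + (x + b2) * z2 + c2 * z3) -
     a2 * ((x + a1) * z1 + b1 * z2 + c1 * z3)); first by rewrite /w2 /w3; ring.
  by rewrite e1 e2; ring.
pose sig a b c := a * w1 + b * w2 + c * w3.
have key : w3 * (w3 * sig a3 b3 c3 - w2 * sig a4 b4 c4) = 0.
  have [->|w3n0] := eqVneq w3 0; first by rewrite mul0r.
  have z3n0 : z3 != 0.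
    apply: contraNneq nz => z30; rewrite z30 !mulr0 in c13 c23.
    by move/eqP: c13; move/eqP: c23; rewrite !mulf_eq0 (negPf w3n0) z30 => /eqP -> /eqP ->.
  apply: (mulIf (expf_neq0 2 z3n0)); rewrite mul0r.
  have e34 : z3 * (a3 * z1 + b3 * z2 + c3 * z3) - z2 * (a4 * z1 + b4 * z2 + c4 * z3) = 0.
    transitivity (z3 * (a3 * z1 + (y + b3) * z2 + c3 * z3)
      - z2 * (a4 * z1 + b4 * z2 + (y + c4) * z3)); first by ring.
    by rewrite e3 e4; ring.
  transitivity (w3 * (w3 * z3 * (a3 * (w1 * z3) + b3 * (w2 * z3) + c3 * (w3 * z3))
     - (w2 * z3) * (a4 * (w1 * z3) + b4 * (w2 * z3) + c4 * (w3 * z3)))).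
    by rewrite /sig; ring.
  rewrite -c13 -c23; transitivity (w3 ^+ 3 * (z3 * (a3 * z1 + b3 * z2 + c3 * z3) -
     z2 * (a4 * z1 + b4 * z2 + c4 * z3))); first by ring.
  by rewrite e34 mulr0.
apply/eqP; rewrite -key /E /S /Z1 /Z2 /Z3 /X1 /X2 !hornerE /= /sig /w1 /w2 /w3; ring.
Qed.

Variables l n m : nat -> C.

(** The general cubic vanishing on the three lines X_2 = X_3 = 0, X_1 = X_3 = 0 and
    X_0 = X_2 = 0. *)
Definition chain_cubic (X : nat -> C) : C :=
  det3 (X 3%N) (X 1%N) 0 0 (X 0%N) (X 2%N) (lin4 l X) (lin4 n X) (lin4 m X).

(* Smoothness at the points where only X_0, or only X_1, is nonzero. *)
Hypothesis m0 : m 0%N != 0.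
Hypothesis l1 : l 1%N != 0.

(** A combination of the rows with coefficients (x, y, 1) is degenerate only for x
    in a finite set s and y in a finite set s', and a combination with coefficients
    (x, y, 0) only if it is proportional to one of the first two rows.  Once g is
    not in s + s', all of these are avoided by the combinations (x, y, t) with
    x + y = g t, which are spanned by (1, -1, 0) and (g, 0, 1). *)
Lemma chain_to_scroll : exists (k : C) (X : 'M[C]_4) mu,
  [/\ k != 0, X \in unitmx & forall v : 'cV_4,
    chain_cubic (fun i => v (inord i) 0) =
    k * scroll_cubic mu (fun i => (X *m v) (inord i) 0)].
Proof.
have [s hs] := degenerate_coordinate_finite (l 3) (n 3) (m 3) (l 1%N) (n 1%N) (m 1%N)
  (l 0%N) (n 0%N) (l 2) (n 2) (m 2) m0.
have [s' hs'] := degenerate_coordinate_finite (m 2) (n 2) (l 2) (m 0%N) (n 0%N) (l 0%N)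
  (m 1%N) (n 1%N) (m 3) (n 3) (l 3) l1.
have [g hg] := exists_notin [seq x + y | x <- s, y <- s'].
pose row3 (f0 f1 f2 : nat -> C) : 'M[C]_(3, 4) :=
  \matrix_(i, j) (if i == 0 then f0 else if i == 1 then f1 else f2) j.
pose R0 := row3 (fun j => (j == 3)%:R) (fun j => (j == 1)%:R) (fun=> 0).
pose R1 := row3 (fun=> 0) (fun j => (j == 0)%:R) (fun j => (j == 2)%:R).
pose R2 := row3 l n m.
pose A i := if i is 0 then R0 - R1 else if i is 1 then g *: R0 + R2 else R0.
have [s1 s2 z nz|k [X [mu [k0 Xu E]]]] := @scroll_of_pencil _ A.
  move=> zA; pose z1 := z 0 0; pose z2 := z 0 1; pose z3 := z 0 2%:R.
  have eqj (j : 'I_4) : z1 * (s1 * (R0 0 j - R1 0 j) + s2 * (g * R0 0 j + R2 0 j)) +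
      z2 * (s1 * (R0 1 j - R1 1 j) + s2 * (g * R0 1 j + R2 1 j)) +
      z3 * (s1 * (R0 2%:R j - R1 2%:R j) + s2 * (g * R0 2%:R j + R2 2%:R j)) = 0.
    have /rowP/(_ j) := zA; rewrite !mxE => e; rewrite -[RHS]e.
    by rewrite sum_ord3 !mxE.
  have zP : (z1, z2, z3) = 0 -> z = 0.
    move=> [h1 h2 h3]; apply/rowP => i; rewrite mxE.
    by case: i => -[|[|[|//]]] hi; [rewrite -[RHS]h1 | rewrite -[RHS]h2 | rewrite -[RHS]h3];
      congr (z _ _); apply: val_inj.
  apply: zP; have := eqj (inord 0); have := eqj (inord 1).
  have := eqj (inord 2); have := eqj (inord 3).
  rewrite !mxE !inordK //= => e3 e2 e1 e0.
  have [s20|s2n0] := eqVneq s2 0.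
    have s1n0 : s1 != 0 by apply: contraNneq nz => ->; rewrite s20.
    have z10 : z1 = 0 by apply: (mulfI s1n0); rewrite mulr0 -e3 s20; ring.
    have z20 : z2 = 0 by apply: (mulfI s1n0); rewrite mulr0 -e1 s20; ring.
    have z30 : z3 = 0.
      apply: (mulfI s1n0); rewrite mulr0; apply/eqP; rewrite -oppr_eq0 -e2 s20.
      by apply/eqP; ring.
    by rewrite z10 z20 z30.
  apply/eqP/negPn/negP => zn0.
  have xs : (s1 + g * s2) / s2 \in s.
    apply: (hs _ (- s1 / s2) z1 z2 z3 zn0); apply: (mulfI s2n0); rewrite mulr0.
    - by rewrite -e3; field.
    - by rewrite -e1; field.
    - by rewrite -e0; field.
    - by rewrite -e2; field.
  have ys : - s1 / s2 \in s'.
    apply: (hs' _ ((s1 + g * s2) / s2) z3 z2 z1).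
    - by apply: contraNneq zn0 => -[-> -> ->].
    - by apply: (mulfI s2n0); rewrite mulr0 -e2; field.
    - by apply: (mulfI s2n0); rewrite mulr0 -e0; field.
    - by apply: (mulfI s2n0); rewrite mulr0 -e1; field.
    - by apply: (mulfI s2n0); rewrite mulr0 -e3; field.
  case/negP: hg; apply/allpairsP; exists ((s1 + g * s2) / s2, - s1 / s2).
  by split=> //=; field.
exists (- k), X, mu; split=> // [|v]; first by rewrite oppr_eq0.
rewrite mulNr -E /pencil_cubic det_mx33 !mxE !sum_ord4 !mxE /=.
rewrite !inordK //= /chain_cubic /lin4 /det3; ring.
Qed.

End Chain.

(** * Lines on a smooth cubic surface *)

Section Cubic.
Variable C : numClosedFieldType.
Notation V := 'rV[C]_4.
Variable T : V -> V -> V -> C.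
Hypothesis TD : forall u v x y, T (u + v) x y = T u x y + T v x y.
Hypothesis TZ : forall k u x y, T (k *: u) x y = k * T u x y.
Hypothesis TC12 : forall u v w, T u v w = T v u w.
Hypothesis TC23 : forall u v w, T u v w = T u w v.
Hypothesis smoothT : forall v, v != 0 -> exists u, T v v u != 0.

Lemma TD2 u v x y : T x (u + v) y = T x u y + T x v y.
Proof. by rewrite TC12 TD !(TC12 x). Qed.
Lemma TD3 u v x y : T x y (u + v) = T x y u + T x y v.
Proof. by rewrite TC23 TD2 !(TC23 x y). Qed.
Lemma TZ2 k u x y : T x (k *: u) y = k * T x u y.
Proof. by rewrite TC12 TZ !(TC12 x). Qed.
Lemma TZ3 k u x y : T x y (k *: u) = k * T x y u.
Proof. by rewrite TC23 TZ2 !(TC23 x y). Qed.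
Definition Tlin := (TD, TD2, TD3, TZ, TZ2, TZ3).

(* Reorder the arguments of T. *)
Ltac Tsort a b := repeat first [rewrite (TC12 b a) | rewrite (TC23 _ b a)].
Ltac Tsort3 a b c := Tsort a b; Tsort a c; Tsort b c; Tsort a b.
Ltac Tsort4 a b c d := Tsort a b; Tsort a c; Tsort a d; Tsort b c; Tsort b d; Tsort c d;
  Tsort a b; Tsort a c; Tsort b c; Tsort a b.

Definition indep2 (a b : V) := forall x y, x *: a + y *: b = 0 -> x = 0 /\ y = 0.
Definition basis4 (a b c d : V) := forall x y z t,
  x *: a + y *: b + z *: c + t *: d = 0 -> [/\ x = 0, y = 0, z = 0 & t = 0].

Lemma basis4_span a b c d : basis4 a b c d ->
  forall v, exists x y z t, v = x *: a + y *: b + z *: c + t *: d.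
Proof.
move=> abcd; pose B : 'M[C]_4 := \matrix_(i < 4) nth 0 [:: a; b; c; d] i.
have BE (u : V) : u *m B =
    u 0 (inord 0) *: a + u 0 (inord 1) *: b + u 0 (inord 2) *: c + u 0 (inord 3) *: d.
  by rewrite mulmx_sum_row sum_ord4 !rowK !inordK.
have Bu : B \in unitmx.
  apply: unitmx_kernel => u; rewrite BE => /abcd[u0 u1 u2 u3].
  apply/rowP => i; rewrite mxE -(inord_val i).
  by case: i => -[|[|[|[|//]]]] hi /=.
move=> v; rewrite -(mulmxKV Bu v) BE; by do 4!eexists.
Qed.

Lemma outside_row_space k (A : 'M[C]_(k, 4)) : (k < 4)%N ->
  exists v : V, ~~ (v <= A)%MS.
Proof.
move=> lt_k4; have : ~~ (1%:M <= A)%MS.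
  apply/negP => /mxrankS; rewrite mxrank1 leqNgt.
  by rewrite (leq_ltn_trans (rank_leq_row A)).
by case/row_subPn => i hi; exists (row i 1%:M).
Qed.

Lemma notin_span_coef k (A : 'M[C]_(k, 4)) (v : V) (u : 'rV_k) t :
  ~~ (v <= A)%MS -> u *m A + t *: v = 0 -> t = 0.
Proof.
move=> vA e; apply/eqP; apply: contraNT vA => t0.
have -> : v = (- t^-1 *: u) *m A.
  apply: (scalerI t0); rewrite -scalemxAl scalerA mulrN divff // scaleN1r.
  by apply/eqP; rewrite -addr_eq0 addrC e.
exact: submxMl.
Qed.

Lemma extend_indep2 a b : indep2 a b -> exists c d, basis4 a b c d.
Proof.
move=> ab; have [c hc] := outside_row_space (col_mx a b) isT.
have [d hd] := outside_row_space (col_mx (col_mx a b) c) isT.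
have sc x : x%:M *m _ = x *: _ := @mul_scalar_mx _ 1 4 x _.
exists c, d => x y z t e.
have t0 : t = 0.
  apply: (notin_span_coef (u := row_mx (row_mx x%:M y%:M) z%:M) hd).
  by rewrite !mul_row_col !mul_scalar_mx.
have z0 : z = 0.
  apply: (notin_span_coef (u := row_mx x%:M y%:M) hc).
  by rewrite !mul_row_col !mul_scalar_mx -[RHS]e t0 scale0r addr0.
move: e; rewrite t0 z0 !scale0r !addr0 => /ab[-> ->]; by [].
Qed.

Lemma extend_vector (p : V) : p != 0 -> exists b c d, basis4 p b c d.
Proof.
move=> p0; have [b hb] := outside_row_space p isT.
suff /extend_indep2[c [d h]] : indep2 p b by exists b, c, d.
move=> x y e; have y0 : y = 0.
  by apply: (notin_span_coef (u := x%:M) hb); rewrite mul_scalar_mx.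
move: e; rewrite y0 scale0r addr0 => /eqP.
by rewrite scaler_eq0 (negPf p0) orbF => /eqP.
Qed.

Lemma smooth_basis a b c d v : basis4 a b c d -> v != 0 ->
  T v v a = 0 -> T v v b = 0 -> T v v c = 0 -> T v v d = 0 -> False.
Proof.
move=> abcd /smoothT[u /eqP + va vb vc vd]; apply.
have [x [y [z [t ->]]]] := basis4_span abcd u.
by rewrite !Tlin va vb vc vd !mulr0 !addr0.
Qed.

Definition line_in a b := [/\ T a a a = 0, T a a b = 0, T a b b = 0 & T b b b = 0].

Lemma basis4_perm a b c d : basis4 a b c d -> basis4 a b d c.
Proof.
move=> h x y z t e; have [|-> -> -> ->] := h x y t z; last by [].
by rewrite -[RHS]e addrAC.
Qed.

Lemma surface_point : exists2 p : V, p != 0 & T p p p = 0.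
Proof.
have e0 : delta_mx 0 0 != 0 :> V.
  by apply/eqP => /rowP/(_ 0)/eqP; rewrite !mxE !eqxx oner_eq0.
have [b [c [d bas]]] := extend_vector e0; set a := delta_mx _ _ in bas.
have [x [y [xy h]]] := binary_cubic_zero (T a a a) (3%:R * T a a b) (3%:R * T a b b) (T b b b).
exists (x *: a + y *: b).
  apply: contraNneq xy => e; have [|-> -> //] := bas x y 0 0.
  by rewrite e !scale0r !addr0.
by rewrite !Tlin; Tsort a b; rewrite -[RHS]h; ring.
Qed.

Lemma tangent_basis p n : indep2 p n -> T p p n = 0 -> T p p p = 0 ->
  exists v w, [/\ basis4 p n v w, T p p v = 0 & T p p w != 0].
Proof.
move=> pn ppn ppp; have [c [d bas]] := extend_indep2 pn.
have p0 : p != 0.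
  apply/eqP => p0; have [|/eqP] := pn 1 0; last by rewrite oner_eq0.
  by rewrite p0 scaler0 scale0r addr0.
wlog d0 : c d bas / T p p d != 0.
  move=> IH; have [d0|] := eqVneq (T p p d) 0; last exact: IH bas.
  have [c0|c0] := eqVneq (T p p c) 0; first by case: (smooth_basis bas p0 ppp ppn c0 d0).
  exact: IH (basis4_perm bas) c0.
exists (c - (T p p c / T p p d) *: d), d; split=> //; last first.
  by rewrite -scaleNr !Tlin; field.
move=> x y z t e; have [|-> -> z0] := bas x y z (t - z * (T p p c / T p p d)).
  by rewrite -[RHS]e; apply/rowP => i; rewrite !mxE; ring.
by rewrite z0 mul0r subr0 => ->.
Qed.

Lemma indep2_tangent p n : T p p p = 0 -> T p p n = 0 -> p != 0 -> n != 0 ->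
  (forall x, T p n x = 0) -> indep2 p n.
Proof.
move=> ppp ppn /smoothT[u ppu] n0 pn x y e.
have x0 : x = 0.
  apply/eqP; have /eqP : x * T p p u = 0.
    have <- : T p (x *: p + y *: n) u = x * T p p u by rewrite !Tlin pn; ring.
    by rewrite e -(scale0r p) !Tlin mul0r.
  by rewrite mulf_eq0 (negPf ppu) orbF.
move: e; rewrite x0 scale0r add0r => /eqP.
by rewrite scaler_eq0 (negPf n0) orbF => /eqP.
Qed.

Lemma zero_on_basis p u v w n m : basis4 p u v w ->
  T n m p = 0 -> T n m u = 0 -> T n m v = 0 -> T n m w = 0 -> forall x, T n m x = 0.
Proof.
move=> bas h1 h2 h3 h4 x; have [a [b [c [d ->]]]] := basis4_span bas x.
by rewrite !Tlin h1 h2 h3 h4; ring.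
Qed.

Definition has_line := exists a b, indep2 a b /\ line_in a b.
(** The polar quadric of p is singular at n, that is, p is on the Hessian surface. *)
Definition has_parabolic_point := exists p n,
  [/\ T p p p = 0, indep2 p n & forall x, T p n x = 0].

Definition gram (b : nat -> V) (q : V) : 'M[C]_4 := \matrix_(i < 4, j < 4) T q (b i) (b j).

Lemma gram_kernel a b c d q : basis4 a b c d ->
  gram (nth 0 [:: a; b; c; d]) q \notin unitmx -> exists2 n, n != 0 & forall x, T q n x = 0.
Proof.
move=> bas /singular_left_kernel[k k0 kG].
exists (k 0 (inord 0) *: a + k 0 (inord 1) *: b + k 0 (inord 2) *: c + k 0 (inord 3) *: d).
  apply: contraNneq k0 => /bas[k0 k1 k2 k3]; apply/eqP/rowP => i.
  by rewrite mxE -(inord_val i); case: i => -[|[|[|[|//]]]] hi /=.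
have E (j : 'I_4) : T q (k 0 (inord 0) *: a + k 0 (inord 1) *: b + k 0 (inord 2) *: c
    + k 0 (inord 3) *: d) (nth 0 [:: a; b; c; d] j) = 0.
  by have /rowP/(_ j) := kG; rewrite mxE sum_ord4 !mxE !inordK //= => <-; rewrite !Tlin.
by apply: (zero_on_basis bas); [have := E (inord 0) | have := E (inord 1)
  | have := E (inord 2) | have := E (inord 3)]; rewrite inordK.
Qed.

Lemma gram_unit a b c d q : (forall n, (forall x, T q n x = 0) -> n = 0) ->
  basis4 a b c d -> gram (nth 0 [:: a; b; c; d]) q \in unitmx.
Proof.
move=> h bas; apply/negPn/negP => /(gram_kernel bas)[n /eqP n0 /h]; exact: n0.
Qed.

(** The tangent section at p has a node with tangents u and v; the line in the
    direction a u + v meets it again at the point P a.  The Hessian of P a is a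
    polynomial of degree twelve in a, whose leading and constant coefficients are
    multiples of the Hessian of p, which is nonzero at a node.  So it has a root
    a <> 0, for which P a is not the node. *)
Lemma node_parabolic p u v w : basis4 p u v w ->
  T p p p = 0 -> T p p u = 0 -> T p p v = 0 -> T p p w != 0 ->
  T p u u = 0 -> T p v v = 0 -> T p u v != 0 -> T u u u != 0 -> T v v v != 0 ->
  has_parabolic_point.
Proof.
move=> bas ppp ppu ppv ppw puu pvv puv uuu vvv.
pose e := nth (0 : V) [:: p; u; v; w].
have gram_p : gram e p \in unitmx.
  apply: gram_unit => // n n0; have [x [y [z [t nE]]]] := basis4_span bas n.
  have t0 : t = 0.
    apply: (mulIf ppw); rewrite mul0r -(n0 p) nE !Tlin; Tsort4 p u v w.
    by rewrite ppp ppu ppv; ring.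
  have y0 : y = 0.
    apply: (mulIf puv); rewrite mul0r -(n0 v) nE !Tlin t0; Tsort4 p u v w.
    by rewrite ppv pvv; ring.
  have z0 : z = 0.
    apply: (mulIf puv); rewrite mul0r -(n0 u) nE !Tlin t0; Tsort4 p u v w.
    by rewrite ppu puu; ring.
  have x0 : x = 0.
    by apply: (mulIf ppw); rewrite mul0r -(n0 w) nE !Tlin t0 y0 z0; ring.
  by rewrite nE x0 y0 z0 t0 !scale0r !addr0.
pose b := 6%:R * T p u v.
pose K : {poly C} := (T u u u)%:P * ('X * 'X * 'X) + (3%:R * T u u v)%:P * ('X * 'X)
  + (3%:R * T u v v)%:P * 'X + (T v v v)%:P.
pose P a := (b * a ^+ 2) *: u + (b * a) *: v + (- K.[a]) *: p.
pose M : 'M[{poly C}]_4 := \matrix_(i, j) ((b * T u (e i) (e j))%:P * ('X * 'X)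
   + (b * T v (e i) (e j))%:P * 'X - (T p (e i) (e j))%:P * K).
have lK : has_lead K 3 (T u u u).
  have X2 := has_leadM (has_leadX C) (has_leadX C); have X3 := has_leadM X2 (has_leadX C).
  have -> : T u u u = T u u u * (1 * 1 * 1) by ring.
  exact: has_leadDl (has_leadDl (has_leadDl (has_leadZ _ X3) (has_leadZ _ X2) _)
    (has_leadZ _ (has_leadX C)) _) (has_leadC _) _.
have lM : has_lead (\det M) (4 * 3)
    (\det (\matrix_(i < 4, j < 4) (- T u u u * T p (e i) (e j)))).
  apply: has_lead_det => i j; rewrite !mxE.
  have X2 := has_leadM (has_leadX C) (has_leadX C).
  have -> : - T u u u * T p (e i) (e j) = - (T p (e i) (e j) * T u u u) by ring.
  rewrite addrC.
  exact: has_leadDl (has_leadN (has_leadZ _ lK))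
    (has_leadDl (has_leadZ _ X2) (has_leadZ _ (has_leadX C)) _) _.
have ME a : (\det M).[a] = \det (gram e (P a)).
  rewrite -horner_evalE -det_map_mx; congr (\det _); apply/matrixP => i j.
  by rewrite !mxE /= horner_evalE /P !Tlin /K !hornerE /=; ring.
have detN0 k : k != 0 -> \det (\matrix_(i < 4, j < 4) (k * T p (e i) (e j))) != 0.
  move=> k0; have -> : \matrix_(i < 4, j < 4) (k * T p (e i) (e j)) = k *: gram e p.
    by apply/matrixP => i j; rewrite !mxE.
  by rewrite detZ mulf_neq0 ?expf_neq0 // -unitfE -unitmxE.
have uuuN : - T u u u != 0 by rewrite oppr_eq0.
have [a /eqP] := has_lead_root lM isT (detN0 _ uuuN).
rewrite ME => detP.
have b0 : b != 0 by rewrite mulf_neq0 // pnatr_eq0.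
have a0 : a != 0.
  apply: contra_eq_neq detP => ->; have -> : gram e (P 0) =
      \matrix_(i < 4, j < 4) (- T v v v * T p (e i) (e j)).
    apply/matrixP => i j; rewrite !mxE /P !Tlin /K !hornerE /=; ring.
  by apply: detN0; rewrite oppr_eq0.
have P0 : P a != 0.
  apply/eqP => P0; have [|_ /eqP] := bas (- K.[a]) (b * a ^+ 2) (b * a) 0.
    by rewrite -[RHS]P0; apply/rowP => i; rewrite !mxE; ring.
  by rewrite mulf_eq0 expf_eq0 /= (negPf b0) (negPf a0).
have [n n0 nP] : exists2 n, n != 0 & forall x, T (P a) n x = 0.
  by apply: (gram_kernel bas); rewrite unitmxE unitfE detP eqxx.
have PPP : T (P a) (P a) (P a) = 0.
  rewrite /P; set k := K.[a].
  have kE : k = T u u u * a ^+ 3 + 3%:R * T u u v * a ^+ 2 + 3%:R * T u v v * a + T v v v.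
    by rewrite /k /K !hornerE /=; ring.
  rewrite !Tlin; Tsort3 p u v; rewrite ppp ppu ppv puu pvv kE /b; ring.
exists (P a), n; split=> //; apply: indep2_tangent => //.
by rewrite TC23 nP.
Qed.

(** The tangent section at a point is cuspidal or nodal at this point, or it
    contains a line through it. *)
Lemma parabolic_point : has_line \/ has_parabolic_point.
Proof.
have [p p0 ppp] := surface_point.
have [n [pn ppn]] : exists n, indep2 p n /\ T p p n = 0.
  have [b [c [d bas]]] := extend_vector p0.
  have [b0|b0] := eqVneq (T p p b) 0.
    exists b; split=> // x y e; have [|-> -> //] := bas x y 0 0.
    by rewrite e !scale0r !addr0.
  exists (c + (- (T p p c / T p p b)) *: b); split; last by rewrite !Tlin; field.
  move=> x y e; have [|-> _ -> //] := bas x (- y * (T p p c / T p p b)) y 0.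
  by rewrite -[RHS]e; apply/rowP => i; rewrite !mxE; ring.
have [v1 [w1 [bas1 ppv1 ppw1]]] := tangent_basis pn ppn ppp.
(* u is an asymptotic direction at p *)
have [x [y [xy quad]]] := binary_quadratic_zero (T p n n) (2%:R * T p n v1) (T p v1 v1).
have [u uE] : exists u, u = x *: n + y *: v1 by eexists.
have pu : indep2 p u.
  move=> k l; rewrite uE => e; have [|-> lx ly _] := bas1 k (l * x) (l * y) 0.
    by rewrite -[RHS]e; apply/rowP => i; rewrite !mxE; ring.
  split=> //; apply/eqP; apply: contraNT xy => l0.
  move/eqP: lx; move/eqP: ly; rewrite !mulf_eq0 (negPf l0) /= => /eqP -> /eqP -> //.
have ppu : T p p u = 0 by rewrite uE !Tlin ppn ppv1; ring.
have puu : T p u u = 0 by rewrite uE !Tlin; Tsort n v1; rewrite -[RHS]quad; ring.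
have [k0|k0] := eqVneq (T u u u) 0; first by left; exists p, u.
have [v [w [bas ppv ppw]]] := tangent_basis pu ppu ppp.
have [b0|b0] := eqVneq (T p u v) 0.
  right; exists p, (u + (- (T p u w / T p p w)) *: p); split=> //.
    move=> k l e; have [|h l0] := pu (k - l * (T p u w / T p p w)) l.
      by rewrite -[RHS]e; apply/rowP => i; rewrite !mxE; ring.
    by move: h; rewrite l0 mul0r subr0.
  apply: (zero_on_basis bas); rewrite !Tlin; Tsort4 p u v w;
    rewrite ?ppp ?ppu ?puu ?ppv ?b0; first [ring | by field].
(* v' is the other asymptotic direction *)
have [v' v'E] : exists v', v' = v + (- (T p v v / (2%:R * T p u v))) *: u by eexists.
have bas' : basis4 p u v' w.
  move=> x' y' z t; rewrite v'E => e.
  have [|-> h z0 ->] := bas x' (y' - z * (T p v v / (2%:R * T p u v))) z t.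
    by rewrite -[RHS]e; apply/rowP => i; rewrite !mxE; ring.
  by move: h; rewrite z0 mul0r subr0.
have ppv' : T p p v' = 0 by rewrite v'E !Tlin ppu ppv; ring.
have puv' : T p u v' != 0 by rewrite v'E !Tlin puu mulr0 addr0.
have pvv' : T p v' v' = 0.
  by rewrite v'E !Tlin; Tsort u v; rewrite puu; field.
have [v0|v0] := eqVneq (T v' v' v') 0.
  left; exists p, v'; split=> // x' y' e; have [|-> _ -> //] := bas' x' 0 y' 0.
  by rewrite -[RHS]e !scale0r !addr0.
right; exact: node_parabolic bas' ppp ppu ppv' ppw puu pvv' puv' k0 v0.
Qed.

(** The tangent section at p has a cusp with tangent u, and P = a u + v + z(a) p
    parametrizes it.  A second point of a line through P can be taken of the form
    D = x u + e p + y w.  Tangency at P determines e; the two remaining conditions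
    are a quadratic and a cubic form in (x, y) with coefficients in C[a].  When a
    tends to infinity the terms with x ~ a^4, e ~ a^6, y ~ 1 dominate, and they
    have no common zero: the coefficient of a^27 in the resultant is
    -27 kap^5 g^6 with g = c kap / (9 eps^2).  A root of the resultant gives the
    line. *)
Lemma line_of_cusp p u v w : basis4 p u v w ->
  T p p p = 0 -> T p p v = 0 -> T p p w != 0 -> (forall x, T p u x = 0) ->
  T p v v != 0 -> T u u u != 0 -> has_line.
Proof.
move=> bas ppp ppv c0 pu eps0 kap0.
have ppu : T p p u = 0 by rewrite TC23 pu.
pose c := T p p w; pose eps := T p v v; pose kap := T u u u.
rewrite -/c in c0; rewrite -/eps in eps0; rewrite -/kap in kap0.
pose X : {poly C} := 'X.
pose K : {poly C} := kap%:P * (X * X * X) + (3%:R * T u u v)%:P * (X * X)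
  + (3%:R * T u v v)%:P * X + (T v v v)%:P.
pose z := (- (3%:R * eps)^-1)%:P * K.
pose ie := eps^-1%:P.
pose au := kap%:P * (X * X) + (2%:R * T u u v)%:P * X + (T u v v)%:P.
pose aw := c%:P * (z * z) + (2%:R * T p v w)%:P * z
  + ((T u u w)%:P * (X * X) + (2%:R * T u v w)%:P * X + (T v v w)%:P).
pose bpw := c%:P * z + (T p v w)%:P.
pose b2 := kap%:P * X + (T u u v)%:P.
pose b1 := (- 2%:R)%:P * (ie * (au * bpw)) + ((2%:R * T u u w)%:P * X + (2%:R * T u v w)%:P).
pose b0 := (- 2%:R)%:P * (ie * (aw * bpw))
  + ((T p w w)%:P * z + ((T u w w)%:P * X + (T v w w)%:P)).
pose c3 := kap%:P.
pose c2 := (3%:R * c)%:P * ((ie * au) * (ie * au)) + (3%:R * T u u w)%:P.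
pose c1 := (6%:R * c)%:P * ((ie * au) * (ie * aw))
  + ((- 3%:R * T p w w)%:P * (ie * au) + (3%:R * T u w w)%:P).
pose c0' := (3%:R * c)%:P * ((ie * aw) * (ie * aw))
  + ((- 3%:R * T p w w)%:P * (ie * aw) + (T w w w)%:P).
pose zeta := - (3%:R * eps)^-1 * kap.
have lX : has_lead X 1 1 := has_leadX C.
have lX2 : has_lead (X * X) 2 1 by have := has_leadM lX lX; rewrite mulr1.
have lX3 : has_lead (X * X * X) 3 1.
  by have := has_leadM lX2 lX; rewrite mulr1.
have lK : has_lead K 3 kap.
  rewrite -[kap]mulr1.
  exact: has_leadDl (has_leadDl (has_leadDl (has_leadZ _ lX3) (has_leadZ _ lX2) _)
    (has_leadZ _ lX) _) (has_leadC _) _.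
have lz : has_lead z 3 zeta by apply: has_leadZ.
have lau : has_lead au 2 kap.
  rewrite -[kap]mulr1.
  exact: has_leadDl (has_leadDl (has_leadZ _ lX2) (has_leadZ _ lX) _) (has_leadC _) _.
have law : has_lead aw 6 (c * (zeta * zeta)).
  exact: has_leadDl (has_leadDl (has_leadZ _ (has_leadM lz lz)) (has_leadZ _ lz) _)
    (has_leadDl (has_leadDl (has_leadZ _ lX2) (has_leadZ _ lX) _) (has_leadC _) _) _.
have lbpw : has_lead bpw 3 (c * zeta).
  exact: has_leadDl (has_leadZ _ lz) (has_leadC _) _.
have lb2 : has_lead b2 1 kap.
  rewrite -[kap]mulr1; exact: has_leadDl (has_leadZ _ lX) (has_leadC _) _.
have lb1 : has_lead b1 5 (- 2%:R * (eps^-1 * (kap * (c * zeta)))).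
  exact: has_leadDl (has_leadZ _ (has_leadZ _ (has_leadM lau lbpw)))
    (has_leadDl (has_leadZ _ lX) (has_leadC _) _) _.
have lb0 : has_lead b0 9 (- 2%:R * (eps^-1 * (c * (zeta * zeta) * (c * zeta)))).
  exact: has_leadDl (has_leadZ _ (has_leadZ _ (has_leadM law lbpw)))
    (has_leadDl (has_leadZ _ lz) (has_leadDl (has_leadZ _ lX) (has_leadC _) _) _) _.
have leu := has_leadZ eps^-1 lau; have lew := has_leadZ eps^-1 law.
have lc3 : has_lead c3 0 kap := has_leadC kap.
have lc2 : has_lead c2 4 (3%:R * c * (eps^-1 * kap * (eps^-1 * kap))).
  exact: has_leadDl (has_leadZ _ (has_leadM leu leu)) (has_leadC _) _.
have lc1 : has_lead c1 8 (6%:R * c * (eps^-1 * kap * (eps^-1 * (c * (zeta * zeta))))).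
  exact: has_leadDl (has_leadZ _ (has_leadM leu lew))
    (has_leadDl (has_leadZ _ leu) (has_leadC _) _) _.
have lc0 : has_lead c0' 12
    (3%:R * c * (eps^-1 * (c * (zeta * zeta)) * (eps^-1 * (c * (zeta * zeta))))).
  exact: has_leadDl (has_leadZ _ (has_leadM lew lew))
    (has_leadDl (has_leadZ _ lew) (has_leadC _) _) _.
have [|a /eqP ra] := has_lead_root (has_lead_res23 lb2 lb1 lb0 lc3 lc2 lc1 lc0) isT.
  have n0 : - 27%:R * kap ^+ 5 * (c * kap / (9%:R * eps ^+ 2)) ^+ 6 != 0.
    by rewrite !(mulf_neq0, expf_neq0, invr_eq0, oppr_eq0) ?pnatr_eq0 // invr_eq0
      !(mulf_neq0, expf_neq0) ?pnatr_eq0.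
  rewrite (_ : res23 _ _ _ _ _ _ _ =
    - 27%:R * kap ^+ 5 * (c * kap / (9%:R * eps ^+ 2)) ^+ 6) // /res23 /zeta.
  by field.
rewrite horner_res23 in ra.
have [x [y [xy hB hC]]] := res23_zero ra.
have [zz zzE] : exists t, t = z.[a] by eexists.
have [AU AUE] : exists t, t = au.[a] by eexists.
have [AW AWE] : exists t, t = aw.[a] by eexists.
have [BP BPE] : exists t, t = bpw.[a] by eexists.
have b2E : b2.[a] = kap * a + T u u v by rewrite /b2 /X !hornerE.
have b1E : b1.[a] = - 2%:R * (eps^-1 * (AU * BP)) + (2%:R * T u u w * a + 2%:R * T u v w).
  by rewrite AUE BPE /b1 /ie /X !(hornerD, hornerM, hornerC, hornerX).
have b0E : b0.[a] = - 2%:R * (eps^-1 * (AW * BP)) + (T p w w * zz + (T u w w * a + T v w w)).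
  by rewrite AWE BPE zzE /b0 /ie /X !(hornerD, hornerM, hornerC, hornerX).
have c2E : c2.[a] = 3%:R * c * (eps^-1 * AU * (eps^-1 * AU)) + 3%:R * T u u w.
  by rewrite AUE /c2 /ie /X !(hornerD, hornerM, hornerC, hornerX).
have c1E : c1.[a] = 6%:R * c * (eps^-1 * AU * (eps^-1 * AW)) +
    (- 3%:R * T p w w * (eps^-1 * AU) + 3%:R * T u w w).
  by rewrite AUE AWE /c1 /ie /X !(hornerD, hornerM, hornerC, hornerX).
have c0E : c0'.[a] = 3%:R * c * (eps^-1 * AW * (eps^-1 * AW)) +
    (- 3%:R * T p w w * (eps^-1 * AW) + T w w w).
  by rewrite AWE /c0' /ie /X !(hornerD, hornerM, hornerC, hornerX).
have c3E : c3.[a] = kap by rewrite /c3 hornerC.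
rewrite b2E b1E b0E in hB; rewrite c3E c2E c1E c0E in hC.
have {}BPE : BP = c * zz + T p v w.
  by rewrite BPE zzE /bpw !(hornerD, hornerM, hornerC).
have {}AUE : AU = kap * a ^+ 2 + 2%:R * T u u v * a + T u v v.
  by rewrite AUE /au /X !(hornerD, hornerM, hornerC, hornerX).
have {}AWE : AW = c * zz ^+ 2 + 2%:R * T p v w * zz
    + (T u u w * a ^+ 2 + 2%:R * T u v w * a + T v v w).
  by rewrite AWE zzE /aw /X !(hornerD, hornerM, hornerC, hornerX).
have zzK : 3%:R * eps * zz =
    - (kap * a ^+ 3 + 3%:R * T u u v * a ^+ 2 + 3%:R * T u v v * a + T v v v).
  by rewrite zzE /z /K /X !(hornerD, hornerM, hornerC, hornerX); field.
pose e := - eps^-1 * (x * AU + y * AW).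
have eE : eps * e = - (x * AU + y * AW) by rewrite /e; field.
pose P := a *: u + v + zz *: p; pose D := x *: u + e *: p + y *: w.
have puu : T p u u = 0 := pu u; have puv : T p u v = 0 := pu v.
have puw : T p u w = 0 := pu w.
exists P, D; split.
  move=> k l E; have [|_ h1 k0 h2] := bas (k * zz + l * e) (k * a + l * x) k (l * y).
    by rewrite -[RHS]E; apply/rowP => i; rewrite !mxE; ring.
  split=> //; apply/eqP; apply: contraNT xy => l0.
  move: h1 h2; rewrite k0 mul0r add0r => /eqP + /eqP.
  by rewrite !mulf_eq0 (negPf l0) /= => /eqP -> /eqP ->.
split; rewrite /P /D !Tlin; Tsort4 p u v w;
  rewrite ?ppp ?ppu ?ppv ?puu ?puv ?puw -/c -/eps -/kap.
- transitivity (3%:R * eps * zz + (kap * a ^+ 3 + 3%:R * T u u v * a ^+ 2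
    + 3%:R * T u v v * a + T v v v)); first by ring.
  by rewrite zzK addNr.
- transitivity (eps * e + (x * AU + y * AW)); first by rewrite AUE AWE; ring.
  by rewrite eE addNr.
- by rewrite -[RHS]hB /e BPE AUE AWE; field.
- by rewrite -[RHS]hC /e AUE AWE; field.
Qed.

Lemma exists_line : has_line.
Proof.
have [//|[p [n [ppp pn pnx]]]] := parabolic_point.
have ppn : T p p n = 0 by rewrite TC23 pnx.
have [v [w [bas ppv ppw]]] := tangent_basis pn ppn ppp.
have [n0|n0] := eqVneq (T n n n) 0.
  by exists p, n; split=> //; split.
have [v0|v0] := eqVneq (T p v v) 0; last exact: line_of_cusp bas ppp ppv ppw pnx v0 n0.
have [x [y [xy h]]] := binary_cubic_zero (T n n n) (3%:R * T n n v) (3%:R * T n v v) (T v v v).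
exists p, (x *: n + y *: v); split.
  move=> k l e; have [|-> h1 h2 _] := bas k (l * x) (l * y) 0.
    by rewrite -[RHS]e; apply/rowP => i; rewrite !mxE; ring.
  split=> //; apply/eqP; apply: contraNT xy => l0.
  by move/eqP: h1; move/eqP: h2; rewrite !mulf_eq0 (negPf l0) /= => /eqP -> /eqP ->.
split; rewrite ?Tlin // ; Tsort n v.
- by rewrite ppn ppv; ring.
- by rewrite !pnx v0; ring.
- by rewrite -[RHS]h; ring.
Qed.

(** * Chains of three lines *)

(** The restriction of the cubic to the plane abw is the line ab and a residual
    conic; Delta is the determinant of a symmetric matrix of this conic, rescaled
    to avoid denominators. *)
Definition Delta a b w : C :=
  det3 (T a a w) (T a b w) (T a w w) (T a b w) (T b b w) (T b w w)
       (3%:R * T a w w) (3%:R * T b w w) (4%:R * T w w w).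

Lemma det3_kernel (a b c d e f g h i : C) : det3 a b c d e f g h i = 0 ->
  exists x y z : C, [/\ (x, y, z) != 0, a * x + b * y + c * z = 0,
    d * x + e * y + f * z = 0 & g * x + h * y + i * z = 0].
Proof.
pose L : seq (seq C) := [:: [:: a; b; c]; [:: d; e; f]; [:: g; h; i]].
pose M : 'M[C]_3 := \matrix_(i < 3, j < 3) nth 0 (nth [::] L j) i.
move=> det0; have /eqP/det0P[v v0 vM] : \det M = 0.
  by rewrite det_mx33 !mxE /= -[RHS]det0 /det3; ring.
have E k : v 0 0 * M 0 k + v 0 1 * M 1 k + v 0 2%:R * M 2%:R k = 0.
  by have /rowP/(_ k) := vM; rewrite mxE sum_ord3 => ->; rewrite mxE.
exists (v 0 0), (v 0 1), (v 0 2%:R); split.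
- apply: contraNneq v0 => -[h0 h1 h2]; apply/eqP/rowP => k; rewrite mxE.
  by case: k => -[|[|[|//]]] hi; [rewrite -[RHS]h0 | rewrite -[RHS]h1 | rewrite -[RHS]h2];
    congr (v _ _); apply: val_inj.
- by rewrite -[RHS](E 0) !mxE /=; ring.
- by rewrite -[RHS](E 1) !mxE /=; ring.
- by rewrite -[RHS](E 2%:R) !mxE /=; ring.
Qed.

Lemma basis4_change a b c d x y r s u v : x * s - y * r != 0 -> basis4 a b c d ->
  basis4 (x *: a + y *: b) (r *: a + s *: b) (c + (u *: a + v *: b)) d.
Proof.
move=> nz abcd k l m n e.
have [|h1 h2 m0 n0] := abcd (k * x + l * r + m * u) (k * y + l * s + m * v) m n.
  by rewrite -[RHS]e; apply/rowP => i; rewrite !mxE; ring.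
move: h1 h2; rewrite m0 n0 !mul0r !addr0 => h1 h2; split=> //; apply: (mulIf nz).
  rewrite mul0r; transitivity ((k * x + l * r) * s - (k * y + l * s) * r).
    by ring.
  by rewrite h1 h2 !mul0r subr0.
rewrite mul0r; transitivity ((k * y + l * s) * x - (k * x + l * r) * y).
  by ring.
by rewrite h1 h2 !mul0r subr0.
Qed.

Lemma complete_row (x y : C) : (x, y) != 0 -> exists r s, x * s - y * r != 0.
Proof.
move=> nz; have [x0|x0] := eqVneq x 0; last first.
  by exists 0, 1; rewrite mulr1 mulr0 subr0.
exists 1, 0; rewrite x0 mulr0 mulr1 sub0r oppr_eq0.
by apply: contraNneq nz => ->; rewrite x0.
Qed.

Lemma line_in_change a b x y r s : line_in a b ->
  line_in (x *: a + y *: b) (r *: a + s *: b).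
Proof.
move=> [h1 h2 h3 h4]; split; rewrite !Tlin; Tsort a b;
  by rewrite ?h1 ?h2 ?h3 ?h4; ring.
Qed.

(** A degenerate residual conic splits into two lines; the line nw is one of them.
    It joins the singular point of the conic to a point of the line ab, or of the
    conic when the singular point is on ab. *)
Lemma residual_line a b c d : basis4 a b c d -> line_in a b -> Delta a b c = 0 ->
  exists n m w, [/\ basis4 n m w d, line_in n m,
    [/\ T n n w = 0, T n w w = 0 & T w w w = 0],
    exists x y, n = x *: a + y *: b & exists u v, w = c + (u *: a + v *: b)].
Proof.
move=> abcd ab /det3_kernel[x [y [z [nz e1 e2 e3]]]].
have [h1 h2 h3 h4] := ab.
have [z0|z0] := eqVneq z 0; last first.
  (* the node is off the line *)
  pose u := x / (2%:R * z); pose v := y / (2%:R * z).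
  have [w wE] : exists w, w = c + (u *: a + v *: b) by eexists.
  have w1 : T a w w = 0.
    rewrite wE !Tlin; Tsort3 a b c; rewrite ?h1 ?h2 ?h3 ?h4 /u /v.
    by apply: (mulfI z0); rewrite [RHS]mulr0 -[RHS]e1; field.
  have w2 : T b w w = 0.
    rewrite wE !Tlin; Tsort3 a b c; rewrite ?h1 ?h2 ?h3 ?h4 /u /v.
    by apply: (mulfI z0); rewrite [RHS]mulr0 -[RHS]e2; field.
  have w3 : T w w w = 0.
    rewrite {1}wE !Tlin w1 w2 wE !Tlin; Tsort3 a b c; rewrite ?h1 ?h2 ?h3 ?h4 /u /v.
    have z2 : 2%:R * z != 0 by rewrite mulf_neq0 // pnatr_eq0.
    apply: (mulfI (expf_neq0 2 z2)); rewrite [RHS]mulr0.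
    transitivity (z * (3%:R * T a c c * x + 3%:R * T b c c * y + 4%:R * T c c c * z) +
      x * (T a a c * x + T a b c * y + T a c c * z) +
      y * (T a b c * x + T b b c * y + T b c c * z)); first by field.
    by rewrite e1 e2 e3; ring.
  have [p [q [pq quad]]] := binary_quadratic_zero (T a a c) (2%:R * T a b c) (T b b c).
  have [r [s rs]] := complete_row pq.
  exists (p *: a + q *: b), (r *: a + s *: b), w; split.
  - by rewrite wE; apply: basis4_change.
  - exact: line_in_change.
  - split=> //; last by rewrite !Tlin w1 w2 !mulr0 addr0.
    rewrite wE !Tlin; Tsort3 a b c; rewrite ?h1 ?h2 ?h3 ?h4 -[RHS]quad; ring.
  - by exists p, q.
  - by exists u, v.
(* the node lies on the line *)
have xy : (x, y) != 0 by apply: contraNneq nz => -[-> ->]; rewrite z0.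
move: e1 e2 e3; rewrite z0 !mulr0 !addr0 => e1 e2 e3.
have [r [s rs]] := complete_row xy.
have [n nE] : exists n, n = x *: a + y *: b by eexists.
have [m mE] : exists m, m = r *: a + s *: b by eexists.
have nm : line_in n m by rewrite nE mE; apply: line_in_change.
have nac : T a n c = 0 by rewrite nE !Tlin -[RHS]e1; ring.
have nbc : T b n c = 0 by rewrite nE !Tlin; Tsort a b; rewrite -[RHS]e2; ring.
have nnc : T n n c = 0 by rewrite {1}nE !Tlin nac nbc !mulr0 addr0.
have nmc : T n m c = 0 by rewrite TC12 {1}mE !Tlin nac nbc !mulr0 addr0.
have ncc : T n c c = 0.
  have n3 : 3%:R != 0 :> C by rewrite pnatr_eq0.
  by apply: (mulfI n3); rewrite [RHS]mulr0 -[RHS]e3 nE !Tlin; ring.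
have basis u v : basis4 n m (c + (u *: a + v *: b)) d.
  by rewrite nE mE; apply: basis4_change.
have [k1 k2 k3 k4] := nm.
have mmc : T m m c != 0.
  apply/eqP => mmc.
  have [p [q [pq quad]]] := binary_quadratic_zero (T n n d) (2%:R * T n m d) (T m m d).
  have bas := basis 0 0; rewrite !scale0r !addr0 in bas.
  have v0 : p *: n + q *: m != 0.
    apply: contraNneq pq => e; have [|-> -> //] := bas p q 0 0.
    by rewrite e !scale0r !addr0.
  by apply: (smooth_basis bas v0); rewrite !Tlin; Tsort n m;
    rewrite ?k1 ?k2 ?k3 ?k4 ?nnc ?nmc ?mmc; first [ring | rewrite -[RHS]quad; ring].
have [p [q [pq quad]]] :=
  binary_quadratic_zero (3%:R * T m m c) (3%:R * T m c c) (T c c c).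
have q0 : q != 0.
  apply: contraNneq pq => q0; move: quad; rewrite q0 !mulr0 expr0n !mulr0 !addr0.
  move=> /eqP; rewrite !mulf_eq0 pnatr_eq0 (negPf mmc) /= orbb.
  by move=> /eqP ->.
have [w w'E] : exists w, w = c + ((p / q * r) *: a + (p / q * s) *: b) by eexists.
have wE : w = c + (p / q) *: m.
  by rewrite w'E mE; apply/rowP => i; rewrite !mxE; ring.
exists n, m, w; split=> //; try by rewrite w'E; apply: basis.
- split; rewrite wE !Tlin; Tsort3 n m c; rewrite ?k1 ?k2 ?k3 ?k4 ?nnc ?nmc ?ncc; try by ring.
  by apply: (mulIf (expf_neq0 2 q0)); rewrite [RHS]mul0r -[RHS]quad; field.
- by exists x, y.
- by exists (p / q * r), (p / q * s).
Qed.

(** The expression is T(p, p, d) for p = T(m, w, w) n - 2 T(n, m, w) w, which is the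
    point where the line nw meets the third line of the plane nmw.  This plane is
    tangent at p, so T(p, p, d) = 0 would make p singular.  If both coefficients of
    p were zero, nw would be a double line of the plane section and would contain
    singular points of the surface. *)
Lemma Delta_derivative n m w d : basis4 n m w d -> line_in n m ->
  T n n w = 0 -> T n w w = 0 -> T w w w = 0 ->
  T m w w ^+ 2 * T n n d - 4%:R * T n m w * T m w w * T n w d
    + 4%:R * T n m w ^+ 2 * T w w d != 0.
Proof.
move=> bas [k1 k2 k3 k4] nnw nww www.
have [p pE] : exists p, p = T m w w *: n - (2%:R * T n m w) *: w by eexists.
have p0 : p != 0.
  apply/eqP => p0.
  have [|v0 _ b0 _] := bas (T m w w) 0 (- (2%:R * T n m w)) 0.
    by rewrite -[RHS]p0 pE; apply/rowP => i; rewrite !mxE; ring.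
  have {}b0 : T n m w = 0.
    by move/eqP: b0; rewrite oppr_eq0 mulf_eq0 pnatr_eq0 => /eqP.
  have [x [y [xy quad]]] := binary_quadratic_zero (T n n d) (2%:R * T n w d) (T w w d).
  have q0 : x *: n + y *: w != 0.
    apply: contraNneq xy => e; have [|-> _ -> //] := bas x 0 y 0.
    by rewrite -[RHS]e !scale0r !addr0.
  by apply: (smooth_basis bas q0); rewrite !Tlin; Tsort4 n m w d;
    rewrite ?k1 ?k2 ?k3 ?k4 ?nnw ?nww ?www ?v0 ?b0; first [ring | rewrite -[RHS]quad; ring].
apply/eqP => e0; apply: (smooth_basis bas p0); rewrite pE -?scaleNr !Tlin; Tsort4 n m w d;
  rewrite ?k1 ?k2 ?k3 ?k4 ?nnw ?nww ?www; first [ring | rewrite -[RHS]e0; ring].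
Qed.

Lemma nonzero_root (P : {poly C}) n : P`_n.+2 != 0 -> P.[0] = 0 ->
  P^`().[0] != 0 -> exists2 r, r != 0 & P.[r] = 0.
Proof.
move=> cP P0; have /factor_theorem[Q PQ] : root P 0 by rewrite rootE P0.
rewrite {}PQ subr0 in cP P0 *; rewrite coefMX /= in cP.
rewrite derivM derivX !hornerE /= => Q0.
have [r /eqP Qr] : exists r, root Q r.
  apply: closed_root_size; rewrite ltnNge; apply: contra cP => sQ.
  by rewrite nth_default // (leq_trans sQ).
exists r; last by rewrite !hornerE /= Qr mul0r.
by apply: contraNneq Q0 => r0; rewrite r0 in Qr; rewrite Qr ?mulr0 ?mulr1 ?addr0.
Qed.

(** Along a line of planes, Delta is a quintic; its derivative at a degenerate plane
    is -3 times the expression of [Delta_derivative]. *)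
Lemma Delta_poly n m w d : line_in n m -> exists P : {poly C},
  [/\ forall t, P.[t] = Delta n m (w + t *: d), P`_5 = Delta n m d &
    T n n w = 0 -> T n w w = 0 -> T w w w = 0 ->
    P^`().[0] = - 3%:R * (T m w w ^+ 2 * T n n d
    - 4%:R * T n m w * T m w w * T n w d + 4%:R * T n m w ^+ 2 * T w w d)].
Proof.
move=> [k1 k2 k3 k4].
pose X : {poly C} := 'X.
pose e11 := (T n n w)%:P + X * (T n n d)%:P.
pose e12 := (T n m w)%:P + X * (T n m d)%:P.
pose e22 := (T m m w)%:P + X * (T m m d)%:P.
pose e13 := (T n w w)%:P + X * (2%:R * T n w d)%:P + X * X * (T n d d)%:P.
pose e23 := (T m w w)%:P + X * (2%:R * T m w d)%:P + X * X * (T m d d)%:P.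
pose e33 := (T w w w)%:P + X * (3%:R * T w w d)%:P + X * X * (3%:R * T w d d)%:P
   + X * X * X * (T d d d)%:P.
pose P := e11 * (4%:R%:P * e22 * e33 - 3%:R%:P * e23 * e23)
  - e12 * (4%:R%:P * e12 * e33 - 3%:R%:P * e13 * e23)
  + e13 * (3%:R%:P * e12 * e23 - 3%:R%:P * e13 * e22).
have PE t : P.[t] = Delta n m (w + t *: d).
  rewrite /P /e11 /e12 /e22 /e13 /e23 /e33 /X !hornerE /=.
  by rewrite /Delta !Tlin; Tsort4 n m w d; rewrite ?k1 ?k2 ?k3 ?k4 /det3; ring.
exists P; split=> // [|nnw nww www]; last first.
  rewrite /P /e11 /e12 /e22 /e13 /e23 /e33 /X nnw nww www.
  by rewrite !derivE !hornerE /=; ring.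
have lX : has_lead X 1 1 := has_leadX C.
have lXX : has_lead (X * X) 2 1 by have := has_leadM lX lX; rewrite mulr1.
have lXXX : has_lead (X * X * X) 3 1 by have := has_leadM lXX lX; rewrite mulr1.
have lC k : has_lead (k%:P : {poly C}) 0 k := has_leadC k.
have low k j : (0 < j)%N -> has_lead (k%:P : {poly C}) j 0.
  exact: has_lead_low.
have l11 : has_lead e11 1 (T n n d).
  by have := has_leadD (low (T n n w) 1%N isT) (has_leadM lX (lC (T n n d)));
    rewrite mul1r add0r.
have l12 : has_lead e12 1 (T n m d).
  by have := has_leadD (low (T n m w) 1%N isT) (has_leadM lX (lC (T n m d)));
    rewrite mul1r add0r.
have l22 : has_lead e22 1 (T m m d).
  by have := has_leadD (low (T m m w) 1%N isT) (has_leadM lX (lC (T m m d)));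
    rewrite mul1r add0r.
have lX2 k : has_lead (X * k%:P) 2 0.
    exact: has_lead_low (has_leadM lX (lC k)) _.
have l13 : has_lead e13 2 (T n d d).
  by have := has_leadD (has_leadD (low (T n w w) 2 isT) (lX2 (2%:R * T n w d)))
    (has_leadM lXX (lC (T n d d))); rewrite mul1r !add0r.
have l23 : has_lead e23 2 (T m d d).
  by have := has_leadD (has_leadD (low (T m w w) 2 isT) (lX2 (2%:R * T m w d)))
    (has_leadM lXX (lC (T m d d))); rewrite mul1r !add0r.
have l33 : has_lead e33 3 (T d d d).
  have lX3 k : has_lead (X * k%:P) 3 0.
    exact: has_lead_low (has_leadM lX (lC k)) _.
  have lXX3 k : has_lead (X * X * k%:P) 3 0.
    exact: has_lead_low (has_leadM lXX (lC k)) _.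
  by have := has_leadD (has_leadD (has_leadD (low (T w w w) 3 isT) (lX3 (3%:R * T w w d)))
    (lXX3 (3%:R * T w d d)))
    (has_leadM lXXX (lC (T d d d))); rewrite mul1r !add0r.
have [_ P5] := has_leadD (has_leadB (has_leadM l11 (has_leadB
    (has_leadM (has_leadM (lC 4%:R) l22) l33) (has_leadM (has_leadM (lC 3%:R) l23) l23)))
    (has_leadM l12 (has_leadB (has_leadM (has_leadM (lC 4%:R) l12) l33)
    (has_leadM (has_leadM (lC 3%:R) l13) l23))))
    (has_leadM l13 (has_leadB (has_leadM (has_leadM (lC 3%:R) l12) l23)
    (has_leadM (has_leadM (lC 3%:R) l13) l22))).
by rewrite -/P in P5; rewrite P5 /Delta /det3; ring.
Qed.

Lemma second_root n m w d : basis4 n m w d -> line_in n m ->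
  T n n w = 0 -> T n w w = 0 -> T w w w = 0 ->
  exists2 d', basis4 n m w d' & Delta n m d' = 0.
Proof.
move=> bas nm nnw nww www.
have [D0|D0] := eqVneq (Delta n m d) 0; first by exists d.
have [P [PE P5 dP]] := Delta_poly w d nm.
have [|||r r0 Pr] := @nonzero_root P 3; rewrite ?P5 //.
- rewrite PE scale0r addr0 /Delta nnw nww www /det3; ring.
- by rewrite dP // mulf_neq0 ?oppr_eq0 ?pnatr_eq0 //; apply: Delta_derivative.
exists (w + r *: d); last by rewrite -PE.
move=> x y z t e; have [|-> -> zt /eqP] := bas x y (z + t) (t * r).
  by rewrite -[RHS]e; apply/rowP => i; rewrite !mxE; ring.
rewrite mulf_eq0 (negPf r0) orbF => /eqP t0.
by move: zt; rewrite t0 addr0 => ->.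
Qed.

Definition chain a b c d := [/\ line_in a b, line_in a c & line_in b d].

(** The quintic Delta has a root, which is simple, and hence another one.  The
    corresponding planes give lines nw and n'w' meeting the given line in n and n'.
    These points are distinct, since three non-coplanar lines of the surface through
    a point would make it singular. *)
Lemma chain_of_line a b : indep2 a b -> line_in a b ->
  exists a b c d, basis4 a b c d /\ chain a b c d.
Proof.
move=> /extend_indep2[c0 [d0 bas0]] ab.
have {c0 d0 bas0} [c [d [bas Dc]]] : exists c d, basis4 a b c d /\ Delta a b c = 0.
  have [D0|D0] := eqVneq (Delta a b d0) 0.
    by exists d0, c0; split=> //; apply: basis4_perm.
  have [P [PE P5 _]] := Delta_poly c0 d0 ab.
  have [r /eqP Pr] : exists r, root P r.
    apply: closed_root_size; rewrite ltnNge; apply: contra D0 => sP.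
    by rewrite -P5 nth_default // (leq_trans sP).
  exists (c0 + r *: d0), d0; split; last by rewrite -PE.
  move=> x y z t e; have [|-> -> z0] := bas0 x y z (t + z * r).
    by rewrite -[RHS]e; apply/rowP => i; rewrite !mxE; ring.
  by rewrite z0 mul0r addr0 => ->.
have [n [m [w [bas1 nm [nnw nww www] _ _]]]] := residual_line bas ab Dc.
have [d' bas2 D'] := second_root bas1 nm nnw nww www.
have [n' [m' [w' [bas3 nm' [nnw' nww' www'] [x [y n'E]] [u [v w'E]]]]]] :=
  residual_line (basis4_perm bas2) nm D'.
have [k1 k2 k3 k4] := nm.
have y0 : y != 0.
  apply/eqP => y0; have x0 : x != 0.
    apply/eqP => x0; have [|/eqP] := bas3 1 0 0 0; last by rewrite oner_eq0.
    by rewrite n'E x0 y0 !(scale0r, scaler0, addr0).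
  have n0 : n != 0.
    apply/eqP => n0; have [|/eqP] := bas3 1 0 0 0; last by rewrite oner_eq0.
    by rewrite n'E n0 y0 !(scale0r, scaler0, addr0).
  apply: (smooth_basis bas2 n0 k1 k2 nnw).
  apply: (mulfI (expf_neq0 2 x0)); rewrite [RHS]mulr0 -[RHS]nnw' n'E w'E y0 scale0r addr0.
  by rewrite !Tlin k1 k2; ring.
exists n, n', w, w'; split.
  move=> k l p q; rewrite n'E w'E => e.
  have [|h1 h2 -> q0] := bas2 (k + l * x + q * u) (l * y + q * v) p q.
    by rewrite -[RHS]e; apply/rowP => i; rewrite !mxE; ring.
  move: h1 h2; rewrite q0 !mul0r !addr0 => h1 /eqP; rewrite mulf_eq0 (negPf y0) orbF.
  by move/eqP => l0; move: h1; rewrite l0 mul0r addr0 => ->.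
have [r1 r2 r3 r4] := nm'.
split=> //; split=> //; rewrite n'E !Tlin; Tsort n m; rewrite ?k1 ?k2 ?k3 ?k4; ring.
Qed.

(** * From a chain of lines to the Hankel form *)

Lemma scroll_cubic_ext (mu : nat -> nat -> C) (X Y : nat -> C) :
  (forall i, (i < 4)%N -> X i = Y i) -> scroll_cubic mu X = scroll_cubic mu Y.
Proof. by move=> XY; rewrite /scroll_cubic /lin4 !XY. Qed.

(** In a basis adapted to a chain of three lines, the coefficients of the cubic are
    those of [chain_cubic]. *)
Lemma scroll_form : exists (k : C) (N : 'M[C]_4) mu, [/\ k != 0, N \in unitmx &
  forall x : V, T (x *m N) (x *m N) (x *m N) =
    k * scroll_cubic mu (fun i => x 0 (inord i))].
Proof.
have [a0 [b0 [ab0 line0]]] := exists_line.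
have [a [b [c [d [bas [ab ac bd]]]]]] :=
  chain_of_line ab0 line0.
have [aaa aab abb bbb] := ab; have [_ aac acc ccc] := ac; have [_ bbd bdd ddd] := bd.
have aad : T a a d != 0.
  apply/eqP => aad; apply: (smooth_basis bas _ aaa aab aac aad).
  apply/eqP => a_0; have [|/eqP] := bas 1 0 0 0; last by rewrite oner_eq0.
  by rewrite a_0 !(scaler0, scale0r, addr0).
have bbc : T b b c != 0.
  have bba : T b b a = 0 by Tsort a b.
  apply/eqP => bbc; apply: (smooth_basis bas _ bba bbb bbc bbd).
  apply/eqP => b_0; have [|_ /eqP] := bas 0 1 0 0; last by rewrite oner_eq0.
  by rewrite b_0 !(scaler0, scale0r, addr0).
pose coef (x y z t : C) i := nth 0 [:: x; y; z; t] i.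
pose l := coef (6%:R * T a b c) (3%:R * T b b c) (3%:R * T b c c) (6%:R * T b c d).
pose n := coef 0 0 (- (3%:R * T c c d)) (- (3%:R * T c d d)).
pose m := coef (3%:R * T a a d) (6%:R * T a b d) (6%:R * T a c d) (3%:R * T a d d).
have n3 : 3%:R != 0 :> C by rewrite pnatr_eq0.
have [k [X [mu [k0 Xu E]]]] :=
  @chain_to_scroll C l n m (mulf_neq0 n3 aad) (mulf_neq0 n3 bbc).
pose B : 'M[C]_4 := \matrix_(i < 4) nth 0 [:: a; b; c; d] i.
have BE (u : V) : u *m B =
    u 0 (inord 0) *: a + u 0 (inord 1) *: b + u 0 (inord 2) *: c + u 0 (inord 3) *: d.
  by rewrite mulmx_sum_row sum_ord4 !rowK !inordK.
have Bu : B \in unitmx.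
  apply: unitmx_kernel => u; rewrite BE => /bas[u0 u1 u2 u3].
  apply/rowP => i; rewrite mxE -(inord_val i).
  by case: i => -[|[|[|[|//]]]] hi /=.
have chainE (u : V) : T (u *m B) (u *m B) (u *m B) =
    chain_cubic l n m (fun i => u^T (inord i) 0).
  rewrite BE !Tlin /chain_cubic /det3 /lin4 /l /n /m /coef /= !mxE; Tsort4 a b c d.
  rewrite aaa aab abb bbb aac acc ccc bbd bdd ddd; ring.
exists k, (invmx X^T *m B), mu; split=> //.
  by rewrite unitmx_mul unitmx_inv unitmx_tr Xu.
move=> x; rewrite !mulmxA chainE E; congr (k * _); apply: scroll_cubic_ext => i _.
by rewrite trmx_mul trmx_inv trmxK mulKVmx // mxE.
Qed.

Lemma hankel_form : exists (k : C) (N : 'M[C]_4) (c e : nat -> C),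
  [/\ k != 0, N \in unitmx & forall h : V, T (h *m N) (h *m N) (h *m N) =
    let s (f : nat -> C) i := lin4 (fun j => f (i + j)%N) (fun j => h 0 (inord j)) in
    k * det3 (s c 0) (s c 1) (s e 0) (s c 1) (s c 2) (s e 1) (s c 2) (s c 3) (s e 2)].
Proof.
have [k [N [mu [k0 Nu NE]]]] := scroll_form.
have rowE (X : nat -> C) : scroll_cubic mu X =
    k^-1 * T ((\row_i X i) *m N) ((\row_i X i) *m N) ((\row_i X i) *m N).
  rewrite NE mulKf //; apply: scroll_cubic_ext => i lt_i4.
  by rewrite mxE inordK.
have [|c [e [Hu He]]] := @hankelization C mu.
  move=> X [i lt_i4 Xi]; pose x : V := \row_i X i.
  have x0 : x *m N != 0.
    apply: contraNneq Xi => xN0; have /rowP/(_ (Ordinal lt_i4)) : x = 0.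
      by rewrite -(mulmxK Nu x) xN0 mul0mx.
    by rewrite !mxE => ->.
  have [u xxu] := smoothT x0.
  pose y := u *m invmx N; have yN : y *m N = u by rewrite mulmxKV.
  pose U i := y 0 (inord i).
  have UE : \row_i U i = y by apply/rowP => j; rewrite mxE /U inord_val.
  exists U; rewrite !rowE UE yN.
  have -> : \row_i (X i + U i) = x + y by rewrite -UE; apply/rowP => j; rewrite !mxE.
  have -> : \row_i (X i - U i) = x - y by rewrite -UE; apply/rowP => j; rewrite !mxE.
  rewrite mulmxDl mulmxBl yN -scaleN1r !Tlin; set q := x *m N in xxu *.
  Tsort q u.
  apply: contraNneq xxu => h; have n6 : k^-1 * 6%:R != 0.
    by rewrite mulf_neq0 ?invr_eq0 ?pnatr_eq0.
  by apply/eqP; apply: (mulfI n6); rewrite mulr0 -[RHS]h; ring.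
set H : 'M[C]_4 := \matrix_(_, _) _ in Hu.
exists k, (H *m N), c, e; split=> //; first by rewrite unitmx_mul Hu.
move=> h /=; rewrite mulmxA NE; congr (k * _).
have hH i : (i < 4)%N -> (h *m H) 0 (inord i) =
    lin4 (fun j => c (i + j)%N) (fun j => h 0 (inord j)).
  move=> lt_i4; rewrite mxE sum_ord4 !mxE !inordK // /lin4.
  by rewrite ![(_ + i)%N]addnC; ring.
have mH i : (i < 3)%N -> lin4 (mu i) (fun l => (h *m H) 0 (inord l)) =
    lin4 (fun j => e (i + j)%N) (fun j => h 0 (inord j)).
  move=> lt_i3; rewrite /lin4 !hH // -!He // /lin4; ring.
by rewrite /scroll_cubic !mH // !hH.
Qed.

End Cubic.

(** * Polarization of cubic forms *)

Section Polarization.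
Variable C : numClosedFieldType.

Section Euler.
Variable n : nat.
Implicit Types p : {mpoly C[n]}.

Lemma euler_homog d p : p \is d.-homog -> \sum_i 'X_i * p^`M(i) = d%:R *: p.
Proof.
move=> hp; rewrite [in RHS](mpolyE p) scaler_sumr.
transitivity (\sum_i \sum_(m <- msupp p) ((m i)%:R * p@_m) *: 'X_[m]).
  apply: eq_bigr => i _; rewrite {1}(mpolyE p) linear_sum mulr_sumr.
  apply: eq_bigr => m _; rewrite /= mderivZ mderivX -!scalerAr scalerA mulrC.
  have [->|mi] := posnP (m i); first by rewrite mul0r !scale0r.
  by rewrite -mpolyXD addmC submK // lep1mP -lt0n.
rewrite exchange_big /= big_seq [RHS]big_seq; apply: eq_bigr => m m_in.
rewrite -scaler_suml -mulr_suml -natr_sum -mdegE.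
by move/dhomogP: hp => /(_ _ m_in) ->; rewrite scalerA.
Qed.

Lemma homog_mderiv d p i : p \is d.+1.-homog -> p^`M(i) \is d.-homog.
Proof.
move/dhomogP=> hp; apply/dhomogP => m; rewrite mcoeff_msupp mcoeff_mderiv => nz.
have : (m + U_(i))%MM \in msupp p.
  by rewrite mcoeff_msupp; apply: contraNneq nz => ->; rewrite mul0rn.
by move/hp => /=; rewrite mdegD mdeg1 addn1 => -[].
Qed.

Lemma homog0_const p : p \is 0.-homog -> p = (p@_0%MM)%:MP.
Proof.
move=> hp.
apply/mpolyP => m; rewrite mcoeffC; case: eqVneq => [<-|m0]; first by rewrite mulr1.
rewrite mulr0; apply: (dhomog_nemf_coeff hp); rewrite /= mdeg_eq0.
by rewrite ?m0 // eq_sym.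
Qed.

Lemma homog0_eval p v : p \is 0.-homog -> p.@[v] = p@_0%MM.
Proof. by move/homog0_const => ->; rewrite mevalC mcoeffC eqxx mulr1. Qed.

Lemma homog_eq0 d p : p \is d.+1.-homog -> (forall i, p^`M(i) = 0) -> p = 0.
Proof.
move=> /euler_homog e dp; have d0 : d.+1%:R != 0 :> C by rewrite pnatr_eq0.
apply: (scalerI d0); rewrite -e scaler0 big1 // => i _.
by rewrite dp mulr0.
Qed.

Lemma euler_eval d p v : p \is d.-homog ->
  d%:R * p.@[v] = \sum_i v i * (p^`M(i)).@[v].
Proof.
move=> /euler_homog e; rewrite -mevalZ -e raddf_sum; apply: eq_bigr => i _.
by rewrite /= mevalM mevalXU.
Qed.

Lemma homog_prod (I : finType) (F : I -> {mpoly C[n]}) (d : I -> nat) :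
  (forall i, F i \is (d i).-homog) -> \prod_i F i \is (\sum_i d i).-homog.
Proof.
move=> h; apply: (big_ind2 (fun q e => q \is e.-homog)); first exact: dhomog1.
  by move=> q1 e1 q2 e2 h1 h2; apply: dhomogM.
by move=> i _; apply: h.
Qed.

End Euler.

Section CubicForm.
Variable F : {mpoly C[4]}.
Hypothesis hF : F \is 3.-homog.
Notation V := 'rV[C]_4.

(** The coefficients of the symmetric trilinear form with polar v v v = F(v). *)
Definition coef3 (i j k : 'I_4) : C := (F^`M(i)^`M(j)^`M(k))@_0%MM / 6%:R.

Definition polar (u v w : V) : C :=
  \sum_i \sum_j \sum_k coef3 i j k * (u 0 i * v 0 j * w 0 k).

Lemma polarD u v x y : polar (u + v) x y = polar u x y + polar v x y.
Proof.
rewrite /polar -big_split; apply: eq_bigr => i _; rewrite -big_split.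
apply: eq_bigr => j _; rewrite -big_split; apply: eq_bigr => k _.
by rewrite !mxE /=; ring.
Qed.

Lemma polarZ a u x y : polar (a *: u) x y = a * polar u x y.
Proof.
rewrite /polar mulr_sumr; apply: eq_bigr => i _; rewrite mulr_sumr.
apply: eq_bigr => j _; rewrite mulr_sumr; apply: eq_bigr => k _.
by rewrite !mxE /=; ring.
Qed.

Lemma polarC12 u v w : polar u v w = polar v u w.
Proof.
rewrite /polar exchange_big; apply: eq_bigr => j _; apply: eq_bigr => i _.
apply: eq_bigr => k _; rewrite /coef3 (mderiv_comm i j); ring.
Qed.

Lemma polarC23 u v w : polar u v w = polar u w v.
Proof.
rewrite /polar; apply: eq_bigr => i _; rewrite exchange_big.
apply: eq_bigr => k _; apply: eq_bigr => j _.
rewrite /coef3 (mderiv_comm j k); ring.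
Qed.

Lemma third_derivative i j k v : (F^`M(i)^`M(j)^`M(k)).@[v] = 6%:R * coef3 i j k.
Proof.
rewrite homog0_eval; first by rewrite /coef3; field.
by do 3!apply: homog_mderiv.
Qed.

Lemma polar_mderiv (v : V) i : 3%:R * polar v v (delta_mx 0 i) = (F^`M(i)).@[fun l => v 0 l].
Proof.
have n2 : 2%:R != 0 :> C by rewrite pnatr_eq0.
apply: (mulfI n2); rewrite (euler_eval _ (homog_mderiv i hF)).
rewrite polarC23 polarC12 /polar (bigD1 i) //= [X in _ + X]big1 => [|l ne_li]; last first.
  apply: big1 => j _; apply: big1 => k _.
  by rewrite !mxE /= (negPf ne_li) !mul0r mulr0.
rewrite addr0 !mulr_sumr; apply: eq_bigr => j _.
have := euler_eval (fun l => v 0 l) (homog_mderiv j (homog_mderiv i hF)).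
rewrite mul1r => ->; rewrite !mulr_sumr; apply: eq_bigr => k _.
by rewrite third_derivative !mxE !eqxx /=; ring.
Qed.

Lemma polar_diag (v : V) : F.@[fun l => v 0 l] = polar v v v.
Proof.
have n6 : 2%:R * 3%:R != 0 :> C by rewrite mulf_neq0 ?pnatr_eq0.
apply: (mulfI n6); rewrite -mulrA (euler_eval _ hF) /polar !mulr_sumr.
apply: eq_bigr => i _; rewrite mulrCA (euler_eval _ (homog_mderiv i hF)) !mulr_sumr.
apply: eq_bigr => j _; rewrite -[X in v 0 j * X]mul1r.
rewrite (euler_eval _ (homog_mderiv j (homog_mderiv i hF))) !mulr_sumr.
apply: eq_bigr => k _; rewrite third_derivative /=; ring.
Qed.

Lemma polar_smooth : smooth_hypersurface F ->
  forall v, v != 0 -> exists u, polar v v u != 0.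
Proof.
move=> smF v v0; have [Fv|] := eqVneq (polar v v v) 0; last by exists v.
have [|//|i Fi] := smF (fun l => v 0 l).
- apply/existsP; apply: contraNT v0; rewrite negb_exists => /forallP hv.
  by apply/eqP/rowP => k; rewrite mxE; apply/eqP; rewrite -[_ == _]negbK hv.
- by rewrite polar_diag.
exists (delta_mx 0 i); apply: contraNneq Fi => e.
by rewrite -polar_mderiv e mulr0.
Qed.

End CubicForm.

(** If F vanishes at every point then so does its polar form, hence its third
    derivatives are zero, and Euler's formula brings this back to F. *)
Lemma homog3_eq0 (F : {mpoly C[4]}) : F \is 3.-homog ->
  (forall v : 'rV_4, F.@[fun l => v 0 l] = 0) -> F = 0.
Proof.
move=> hF F0; have Tvvv v : polar F v v v = 0 by rewrite -polar_diag.
have TD := polarD F; have TZ := polarZ F.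
have TC12 := polarC12 F; have TC23 := polarC23 F.
have TD2 x u v y : polar F x (u + v) y = polar F x u y + polar F x v y.
  by rewrite TC12 TD !(TC12 x).
have TD3 x y u v : polar F x y (u + v) = polar F x y u + polar F x y v.
  by rewrite TC23 TD2 !(TC23 x y).
have Tuvw u v w : polar F u v w = 0.
  have n6 : 6%:R != 0 :> C by rewrite pnatr_eq0.
  apply: (mulfI n6); rewrite mulr0.
  transitivity (polar F (u + v + w) (u + v + w) (u + v + w)
    - polar F (u + v) (u + v) (u + v) - polar F (u + w) (u + w) (u + w)
    - polar F (v + w) (v + w) (v + w) + polar F u u u + polar F v v v + polar F w w w).
    rewrite !(TD, TD2, TD3); repeat first [rewrite (TC12 v u) | rewrite (TC12 w u)
      | rewrite (TC12 w v) | rewrite (TC23 _ v u) | rewrite (TC23 _ w u)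
      | rewrite (TC23 _ w v)]; ring.
  by rewrite !Tvvv; ring.
have F3 i j k : F^`M(i)^`M(j)^`M(k) = 0.
  rewrite [LHS]homog0_const; last by do 3!apply: homog_mderiv.
  have := third_derivative hF i j k (fun=> 0).
  rewrite homog0_eval; last by do 3!apply: homog_mderiv.
  have -> : coef3 F i j k = polar F (delta_mx 0 i) (delta_mx 0 j) (delta_mx 0 k).
    rewrite /polar (bigD1 i) //= (bigD1 j) //= (bigD1 k) //=.
    rewrite !big1 ?addr0 => [|l nl|l nl|l nl].
    - by rewrite !mxE !eqxx /= !mulr1.
    - by apply: big1 => m _; apply: big1 => q _; rewrite !mxE /= (negPf nl) !mul0r mulr0.
    - by apply: big1 => m _; rewrite !mxE /= (negPf nl) mulr0 !mul0r mulr0.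
    - by rewrite !mxE /= (negPf nl) !mulr0.
  by rewrite Tuvw mulr0 => ->; rewrite mpolyC0.
have F2 i j : F^`M(i)^`M(j) = 0.
  by apply: (@homog_eq0 _ 0) => // ; do 2!apply: homog_mderiv.
have F1 i : F^`M(i) = 0 by apply: (@homog_eq0 _ 1) => //; apply: homog_mderiv.
exact: (@homog_eq0 _ 2).
Qed.

End Polarization.

(** * Poncelet surfaces *)

Section Quintics.
Variable C : numClosedFieldType.
Variable s : nat -> nat -> C.

Definition quintic_mon (a : nat) : 'X_{1..2} :=
  (U_(ord0) *+ a + U_(ord_max) *+ (5 - a))%MM.

(** Three functionals on S_5, the j-th one taking the value s j a on x^a y^(5-a). *)
Definition quintic_fun (f : bform C (3 + 2)) : 'rV[C]_3 :=
  \row_(j < 3) \sum_(a < 6) s j a * (mpoly_of_dhomog f)@_(quintic_mon a).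

Lemma quintic_fun_linear : linear quintic_fun.
Proof.
move=> k f g; apply/rowP => j; rewrite !mxE mulr_sumr -big_split.
by apply: eq_bigr => a _; rewrite /= mcoeffD mcoeffZ; ring.
Qed.

HB.instance Definition _ :=
  GRing.isLinear.Build C (bform C (3 + 2)) 'rV[C]_3 _ quintic_fun quintic_fun_linear.

Lemma quintic_fun_bmul (l : 'I_4) (i : 'I_3) j :
  linfun quintic_fun (bmul (bmono C l) (bmono C i)) 0 j = s j (l + i)%N.
Proof.
rewrite lfunE mxE /=.
have lt_li : (l + i < 6)%N by case: l i => l hl [i hi] /=; lia.
have -> : 'X_ord0 ^+ l * 'X_ord_max ^+ (3 - l) * ('X_ord0 ^+ i * 'X_ord_max ^+ (2 - i))
    = 'X_[quintic_mon (l + i)] :> {mpoly C[2]}.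
  rewrite /quintic_mon mpolyXD -!mpolyXn exprD.
  have -> : (5 - (l + i) = (3 - l) + (2 - i))%N by case: l i {lt_li} => l hl [i hi] /=; lia.
  rewrite exprD; ring.
rewrite (bigD1 (Ordinal lt_li)) //= mcoeffX eqxx mulr1 big1 ?addr0 // => a ne.
rewrite mcoeffX; case: eqP; rewrite ?mulr0 // => /mnmP/(_ ord0).
rewrite /quintic_mon !mnmDE !mulmnE !mnm1E /= !mul1n !mul0n !addn0 => e.
by case/eqP: ne; apply: val_inj.
Qed.

End Quintics.

Section Bridge.
Variable C : numClosedFieldType.

Lemma homog_lin_subst n d (A : 'M[C]_n) (F : {mpoly C[n]}) :
  F \is d.-homog -> lin_subst A F \is d.-homog.
Proof.
move=> hF; rewrite /lin_subst comp_mpolyE big_seq; apply: rpred_sum => m m_in.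
apply: rpredZ; move/dhomogP: hF => /(_ m m_in) <-.
rewrite /= mdegE; apply: homog_prod => i.
rewrite -[X in X.-homog]mul1n; apply: dhomogMn; rewrite tnth_mktuple.
by apply: rpred_sum => j _; apply: rpredZ; rewrite dhomogX /= mdeg1.
Qed.

Lemma homog_det n r (M : 'M[{mpoly C[n]}]_r) :
  (forall i j, M i j \is 1.-homog) -> \det M \is r.-homog.
Proof.
move=> hM; apply: rpred_sum => t _; rewrite rpredMsign.
have := homog_prod (fun i => hM i (t i)).
by rewrite sum1_card card_ord.
Qed.

Lemma poncelet_mx_homog n k q i j : @poncelet_mx C n k q i j \is 1.-homog.
Proof.
by rewrite mxE; apply: rpred_sum => l _; apply: rpredZ; rewrite dhomogX /= mdeg1.
Qed.

Lemma lin_subst_eval n (A : 'M[C]_n) (F : {mpoly C[n]}) (h : 'rV[C]_n) :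
  (lin_subst A F).@[fun l => h 0 l] = F.@[fun l => (h *m A^T) 0 l].
Proof.
rewrite comp_mpoly_meval; apply: meval_eq => i; rewrite tnth_mktuple !mxE raddf_sum.
by apply: eq_bigr => j _; rewrite /= mevalZ mevalXU mxE mulrC.
Qed.

(** The functionals are the sequences c, its shift and e of the Hankel form.  They
    are independent, because their determinant G is not zero, and so their common
    kernel has dimension 6 - 3 = 3. *)
Lemma poncelet_surface_cubic (F : {mpoly C[4]}) :
  F != 0 -> F \is 3.-homog -> smooth_hypersurface F -> poncelet_surface 3 F.
Proof.
move=> F0 hF smF.
have [k [N [c [e [k0 Nu hank]]]]] := hankel_form (polarD F) (polarZ F)
  (polarC12 F) (polarC23 F) (polar_smooth hF smF).
pose s j a := if j is 0 then c a else if j is 1 then c a.+1 else e a.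
pose q := linfun (quintic_fun s); pose G := \det (poncelet_mx (n := 3) (k := 2) q).
have entry (h : 'rV[C]_4) (i j : 'I_3) :
    (poncelet_mx (n := 3) (k := 2) q i j).@[fun l => h 0 l] =
    lin4 (fun a => s j (i + a)%N) (fun a => h 0 (inord a)).
  rewrite mxE raddf_sum /= sum_ord4 !mevalZ !mevalXU !quintic_fun_bmul !inordK //.
  by rewrite /lin4 ![(i + _)%N]addnC.
have GE (h : 'rV[C]_4) : G.@[fun l => h 0 l] =
    det3 (lin4 (fun a => c (0 + a)%N) (fun a => h 0 (inord a)))
         (lin4 (fun a => c (1 + a)%N) (fun a => h 0 (inord a)))
         (lin4 (fun a => e (0 + a)%N) (fun a => h 0 (inord a)))
         (lin4 (fun a => c (1 + a)%N) (fun a => h 0 (inord a)))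
         (lin4 (fun a => c (2 + a)%N) (fun a => h 0 (inord a)))
         (lin4 (fun a => e (1 + a)%N) (fun a => h 0 (inord a)))
         (lin4 (fun a => c (2 + a)%N) (fun a => h 0 (inord a)))
         (lin4 (fun a => c (3 + a)%N) (fun a => h 0 (inord a)))
         (lin4 (fun a => e (2 + a)%N) (fun a => h 0 (inord a))).
  rewrite /G -det_map_mx det_mx33.
  have me (i j : 'I_3) : map_mx (meval (fun l => h 0 l))
        (poncelet_mx (n := 3) (k := 2) q) i j =
      lin4 (fun a => s j (i + a)%N) (fun a => h 0 (inord a)) by rewrite mxE entry.
  by rewrite !me.
have hG : G \is 3.-homog by apply: homog_det => i j; apply: poncelet_mx_homog.
have FG : lin_subst N^T F = k *: G.
  apply/eqP; rewrite -subr_eq0; apply/eqP; apply: homog3_eq0 => [|h].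
    by rewrite rpredB ?rpredZ //; apply: homog_lin_subst.
  by rewrite mevalB mevalZ lin_subst_eval trmxK polar_diag // hank GE subrr.
have G0 : G != 0.
  apply: contraNneq F0 => G0; apply/eqP/homog3_eq0 => // v.
  have := lin_subst_eval N^T F (v *m invmx N).
  by rewrite FG G0 scaler0 meval0 trmxK mulmxKV.
(* At a point where G does not vanish, the rows of the matrix span the target. *)
have onto : limg q = fullv.
  apply/eqP/negPn/negP => not_onto; case/eqP: G0; apply: homog3_eq0 => // h.
  apply/eqP/negPn/negP => Gh; case/negP: not_onto; apply/eqP/vspaceP => y.
  rewrite memvf; apply/memv_imgP.
  pose M := map_mx (meval (fun l => h 0 l)) (poncelet_mx (n := 3) (k := 2) q).
  have Mu : M \in unitmx by rewrite unitmxE det_map_mx unitfE.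
  pose r (i : 'I_3) := \sum_(l < 4) h 0 l *: bmul (bmono C l) (bmono C i).
  have qr i : q (r i) = row i M.
    apply/rowP => j; rewrite linear_sum summxE !mxE raddf_sum.
    by apply: eq_bigr => l _; rewrite linearZ !mxE /= mevalZ mevalXU mulrC.
  exists (\sum_i (y *m invmx M) 0 i *: r i); first exact: memvf.
  rewrite linear_sum -[LHS](mulmxKV Mu) mulmx_sum_row.
  by apply: eq_bigr => i _; rewrite linearZ /= qr.
have dimker : \dim (lker q) = 3.
  have := limg_ker_dim q fullv; rewrite capfv onto !dimvf.
  by move/(congr1 (subn^~ 3)); rewrite addnK.
have size_f : size (vbasis (lker q)) == 3 by rewrite size_tuple dimker.
exists N^T, (Tuple size_f), G; split.
- by rewrite unitmx_tr.
- by have /basis_free := vbasisP (lker q).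
- exists q => //=; by have /span_basis := vbasisP (lker q).
- by exists k.
Qed.

End Bridge.

Theorem mainTheorem2 (R : realType) (F : {mpoly R[i][4]}) :
  F != 0 -> F \is 3.-homog -> smooth_hypersurface F -> poncelet_surface 3 F.
Proof. exact: poncelet_surface_cubic. Qed.
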